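(* Let $\delta,H,D>0$ and let $\mathcal H(\delta,H,D)$ be the set of torsion-free groups $\Gamma$ which admit a proper isometric action on some $\delta$-hyperbolic space $(X,d)$ with $\operatorname{Ent}(X,d)\le H$ and $\operatorname{diam}(\Gamma\backslash X)\le D$. Then $\mathcal H(\delta,H,D)$ has cardinality, up to group isomorphism, at most $$N_2(\delta,H,D):=N_1\Big(16\big(\tfrac{\delta}{D}+2\big),\,10HD\Big),$$ where $N_1(\delta,H):=\sum_{i=0}^{N(\delta,H,1)}2^{(2i)^{4\delta+6}}$ and $N(\delta,H,D):=\nu\big(3^5e^{72H(D+\delta)}\big)\cdot\Big(1+\frac{20(D+\delta)}{5D+\delta}\big(\nu(3^5e^{73H(D+4\delta)})+2\big)\Big)$.
   Context: A metric space is $\delta$-hyperbolic if it is proper, geodesic, and every geodesic triangle is $\delta$-thin (any two points of the triangle identified by the canonical tripod approximation, isometric on each side, are at distance $\le\delta$). An isometric action is proper if $\{\gamma:d(x,\gamma x)\le R\}$ is finite for all $R,x$; $\operatorname{diam}(\Gamma\backslash X)$ uses the quotient distance $\inf_\gamma d(x,\gamma y)$. $\operatorname{Ent}(X,d)=\liminf_{R\to\infty}\frac1R\ln\#\{\gamma\in\Gamma:d(x,\gamma x)<R\}$. The function $\nu$ is the nondecreasing integer-valued universal Breuillard–Green–Tao function: for every $K\ge1$, whenever $A,B$ are finite nonempty subsets of a group $G$ with $\#(A\cdot B)\le K(\#A)^{1/2}(\#B)^{1/2}$, there exist a subgroup $G_0$ and a finite normal $L\trianglelefteq G_0$ with $G_0/L$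 nilpotent (with a number of generators bounded in terms of $K$) such that $A$ is covered by $\nu(K)$ left translates of $G_0$. *)

(* Defs.v *)
From Stdlib Require Import Reals List Lia Lra.
Open Scope R_scope.

Record Group := MkGroup {
  gT :> Type;
  gmul : gT -> gT -> gT;
  gone : gT;
  ginv : gT -> gT;
  gassoc : forall x y z, gmul x (gmul y z) = gmul (gmul x y) z;
  gone_l : forall x, gmul gone x = x;
  ginv_l : forall x, gmul (ginv x) x = gone
}.
Arguments gmul {g} _ _.
Arguments gone {g}.
Arguments ginv {g} _.

Fixpoint gpow {G : Group} (g : G) (n : nat) : G :=
  match n with O => gone | S n => gmul g (gpow g n) end.

Definition torsion_free (G : Group) : Prop :=
  forall (g : G) (n : nat), (0 < n)%nat -> gpow g n = gone -> g = gone.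

Definition group_iso (G1 G2 : Group) : Prop :=
  exists (f : G1 -> G2) (h : G2 -> G1),
    (forall x y, f (gmul x y) = gmul (f x) (f y)) /\
    (forall x, h (f x) = x) /\ (forall y, f (h y) = y).

Definition has_card {T : Type} (P : T -> Prop) (n : nat) : Prop :=
  exists l : list T, NoDup l /\ length l = n /\ (forall x, In x l <-> P x).

Definition finite_set {T : Type} (P : T -> Prop) : Prop :=
  exists l : list T, forall x, P x -> In x l.

Definition subgroup {G : Group} (S : G -> Prop) : Prop :=
  S gone /\ (forall x y, S x -> S y -> S (gmul x y)) /\ (forall x, S x -> S (ginv x)).

Definition normal_in {G : Group} (L G0 : G -> Prop) : Prop :=
  subgroup L /\ (forall x, L x -> G0 x) /\
  (forall g x, G0 g -> L x -> L (gmul (ginv g) (gmul x g))).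

Inductive gen {G : Group} (S : G -> Prop) : G -> Prop :=
| gen_base : forall x, S x -> gen S x
| gen_one : gen S gone
| gen_mul : forall x y, gen S x -> gen S y -> gen S (gmul x y)
| gen_inv : forall x, gen S x -> gen S (ginv x).

Definition comm {G : Group} (x y : G) : G :=
  gmul (ginv x) (gmul (ginv y) (gmul x y)).

Fixpoint lcs {G : Group} (G0 : G -> Prop) (k : nat) : G -> Prop :=
  match k with
  | O => G0
  | S k => gen (fun z => exists x y, lcs G0 k x /\ G0 y /\ z = comm x y)
  end.

(* G0/L is nilpotent: some term of the lower central series of G0 lies in L
   (the image of lcs G0 k in G0/L is the k-th term of the l.c.s. of G0/L) *)
Definition nilpotent_mod {G : Group} (G0 L : G -> Prop) : Prop :=
  exists c : nat, forall x, lcs G0 c x -> L x.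

Definition gen_mod_at_most {G : Group} (G0 L : G -> Prop) (k : nat) : Prop :=
  exists gs : list G, (length gs <= k)%nat /\ (forall g, In g gs -> G0 g) /\
    (forall g, G0 g -> gen (fun z => In z gs \/ L z) g).

Definition prodset {G : Group} (A B : G -> Prop) : G -> Prop :=
  fun z => exists a b, A a /\ B b /\ z = gmul a b.

(* Breuillard--Green--Tao property of nu (with some generator bound c) *)
Definition BGT_function (nu : R -> nat) : Prop :=
  (forall K1 K2, 1 <= K1 <= K2 -> (nu K1 <= nu K2)%nat) /\
  exists c : R -> nat,
  forall K, 1 <= K ->
  forall (G : Group) (A B : G -> Prop) (nA nB nAB : nat),
    has_card A nA -> has_card B nB -> (0 < nA)%nat -> (0 < nB)%nat ->
    has_card (prodset A B) nAB ->
    INR nAB <= K * sqrt (INR nA) * sqrt (INR nB) ->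
    exists G0 L : G -> Prop,
      subgroup G0 /\ normal_in L G0 /\ finite_set L /\
      nilpotent_mod G0 L /\ gen_mod_at_most G0 L (c K) /\
      exists ts : list G, (length ts <= nu K)%nat /\
        forall a, A a -> exists t, In t ts /\ G0 (gmul (ginv t) a).

Definition is_metric {X : Type} (d : X -> X -> R) : Prop :=
  (forall x y, 0 <= d x y) /\ (forall x y, d x y = 0 <-> x = y) /\
  (forall x y, d x y = d y x) /\ (forall x y z, d x z <= d x y + d y z).

Definition mopen {X : Type} (d : X -> X -> R) (U : X -> Prop) : Prop :=
  forall x, U x -> exists r, 0 < r /\ forall y, d x y < r -> U y.

Definition mcompact {X : Type} (d : X -> X -> R) (K : X -> Prop) : Prop :=
  forall (I : Type) (U : I -> X -> Prop),
    (forall i, mopen d (U i)) -> (forall x, K x -> exists i, U i x) ->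
    exists l : list I, forall x, K x -> exists i, In i l /\ U i x.

Definition proper_space {X : Type} (d : X -> X -> R) : Prop :=
  forall x r, mcompact d (fun y => d x y <= r).

Definition geod_seg {X : Type} (d : X -> X -> R) (a b : X) (gam : R -> X) : Prop :=
  gam 0 = a /\ gam (d a b) = b /\
  forall s t, 0 <= s <= d a b -> 0 <= t <= d a b -> d (gam s) (gam t) = Rabs (s - t).

Definition geodesic_space {X : Type} (d : X -> X -> R) : Prop :=
  forall a b, exists gam, geod_seg d a b gam.

Definition gprod {X : Type} (d : X -> X -> R) (x y z : X) : R :=
  (d x y + d x z - d y z) / 2.

(* every geodesic triangle is delta-thin: points identified by the tripod
   map (same distance t <= Gromov product from a common vertex) are
   delta-close *)
Definition thin_triangles {X : Type} (d : X -> X -> R) (delta : R) : Prop :=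
  forall (x y z : X) (s1 s2 s3 : R -> X),
    geod_seg d x y s1 -> geod_seg d y z s2 -> geod_seg d z x s3 ->
    (forall t, 0 <= t <= gprod d x y z -> d (s1 t) (s3 (d z x - t)) <= delta) /\
    (forall t, 0 <= t <= gprod d y x z -> d (s1 (d x y - t)) (s2 t) <= delta) /\
    (forall t, 0 <= t <= gprod d z x y -> d (s3 t) (s2 (d y z - t)) <= delta).

Definition hyperbolic_space {X : Type} (d : X -> X -> R) (delta : R) : Prop :=
  is_metric d /\ proper_space d /\ geodesic_space d /\ thin_triangles d delta.

Definition isom_action (G : Group) {X : Type} (d : X -> X -> R) (act : G -> X -> X) : Prop :=
  (forall x, act gone x = x) /\
  (forall g h x, act (gmul g h) x = act g (act h x)) /\
  (forall g x y, d (act g x) (act g y) = d x y).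

Definition proper_action (G : Group) {X : Type} (d : X -> X -> R) (act : G -> X -> X) : Prop :=
  forall x r, finite_set (fun g : G => d x (act g x) <= r).

(* Ent(X,d) = liminf_{R->oo} (1/R) ln #{g : d(x,gx) < R} <= H (basepoint x) *)
Definition entropy_le (G : Group) {X : Type} (d : X -> X -> R) (act : G -> X -> X) (H : R) : Prop :=
  exists x : X, forall eps, 0 < eps -> forall R0,
    exists (Rr : R) (n : nat), R0 <= Rr /\ 0 < Rr /\
      has_card (fun g : G => d x (act g x) < Rr) n /\ ln (INR n) / Rr <= H + eps.

(* diam(Gamma \ X) <= D, with quotient distance inf_g d(x, g y) *)
Definition quotient_diam_le (G : Group) {X : Type} (d : X -> X -> R) (act : G -> X -> X) (D : R) : Prop :=
  forall x y : X, forall eps, 0 < eps -> exists g : G, d x (act g y) <= D + eps.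

Definition in_class_H (delta H D : R) (G : Group) : Prop :=
  torsion_free G /\
  exists (X : Type) (d : X -> X -> R) (act : G -> X -> X),
    hyperbolic_space d delta /\ isom_action G d act /\ proper_action G d act /\
    entropy_le G d act H /\ quotient_diam_le G d act D.

(* x^y for x >= 0, y > 0, with 0^y = 0 *)
Definition rpow (x y : R) : R :=
  match Rle_dec x 0 with left _ => 0 | right _ => Rpower x y end.

Definition Nfun (nu : R -> nat) (delta H D : R) : R :=
  INR (nu (243 * exp (72 * H * (D + delta)))) *
  (1 + 20 * (D + delta) / (5 * D + delta) *
       (INR (nu (243 * exp (73 * H * (D + 4 * delta)))) + 2)).

Definition nat_floor (x : R) : nat := Z.to_nat (Int_part x).

Definition N1 (nu : R -> nat) (delta H : R) : R :=
  sum_f_R0 (fun i => Rpower 2 (rpow (2 * INR i) (4 * delta + 6)))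
           (nat_floor (Nfun nu delta H 1)).

Definition N2 (nu : R -> nat) (delta H D : R) : R :=
  N1 nu (16 * (delta / D + 2)) (10 * H * D).

(* Main.v *)
Require Import Defs.
From Stdlib Require Import Reals List Lia Lra ZArith Classical ClassicalEpsilon Permutation Wf_nat.
Open Scope R_scope.

(** Fix a base point [x] and measure [g] by [l g = d x (g x)], so that the group becomes a
coarsely geodesic four-point hyperbolic space on its own.

For [s] larger than the entropy, [sum_g exp (- s * l (g h))] does not depend on [h].
Summing it over all [h] in a ball of radius [R], only those [h] pointing backwards from
[g] contribute much, and these lie in a ball of radius about [R / 2]: this bounds the
ratio of the cardinalities of two concentric balls. So the Breuillard-Green-Tao property
applies to a ball, and torsion-freeness turns its conclusion into a covering of the ball
by few cosets of a nilpotent group [G0]. If some short [g] conjugates [G0] to a group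
meeting [G0] trivially, the cosets separate the short elements of the conjugate, so [G0]
has few short elements, and a smaller ball has at most [nu K ^ 2] elements. Otherwise a
central element [z] of [G0] commutes with all its conjugates by short elements; since
centralizers are cyclic, the whole group is.

Finally, the partial multiplication table of a ball of radius [4 (D + delta)] determines
the group up to isomorphism, and there are at most [2 ^ (m ^ 3)] tables on [m] elements. *)

(** * Groups *)

Lemma ginv_r {G : Group} (x : G) : gmul x (ginv x) = gone.
Proof.
  rewrite <- (gone_l G (gmul x (ginv x))), <- (ginv_l G (ginv x)) at 1.
  rewrite <- gassoc, (gassoc G (ginv x) x), ginv_l, gone_l. apply ginv_l.
Qed.

Lemma gone_r {G : Group} (x : G) : gmul x gone = x.
Proof. rewrite <- (ginv_l G x), gassoc, ginv_r. apply gone_l. Qed.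

Lemma gassoc' {G : Group} (x y z : G) : gmul (gmul x y) z = gmul x (gmul y z).
Proof. symmetry. apply gassoc. Qed.

Lemma ginv_mulK {G : Group} (x y : G) : gmul (ginv x) (gmul x y) = y.
Proof. now rewrite gassoc, ginv_l, gone_l. Qed.

Lemma gmul_invK {G : Group} (x y : G) : gmul x (gmul (ginv x) y) = y.
Proof. now rewrite gassoc, ginv_r, gone_l. Qed.

Lemma gmul_cancel_l {G : Group} (x y z : G) : gmul x y = gmul x z -> y = z.
Proof. intros E. now rewrite <- (ginv_mulK x y), E, ginv_mulK. Qed.

Lemma gmul_cancel_r {G : Group} (x y z : G) : gmul y x = gmul z x -> y = z.
Proof.
  intros E. rewrite <- (gone_r y), <- (gone_r z), <- (ginv_r x), !gassoc. now rewrite E.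
Qed.

Lemma ginv_unique {G : Group} (x y : G) : gmul x y = gone -> y = ginv x.
Proof. intros E. apply (gmul_cancel_l x). now rewrite E, ginv_r. Qed.

Lemma ginv_mul {G : Group} (x y : G) : ginv (gmul x y) = gmul (ginv y) (ginv x).
Proof. symmetry. apply ginv_unique. now rewrite gassoc', gmul_invK, ginv_r. Qed.

Lemma ginvK {G : Group} (x : G) : ginv (ginv x) = x.
Proof. symmetry. apply ginv_unique, ginv_l. Qed.

Lemma ginv_one {G : Group} : ginv gone = (gone : G).
Proof. symmetry. apply ginv_unique, gone_l. Qed.

Lemma ginv_one_iff {G : Group} (x : G) : ginv x = gone -> x = gone.
Proof. intros E. now rewrite <- (ginvK x), E, ginv_one. Qed.

#[local] Hint Rewrite @gassoc' gone_l @gone_r ginv_l @ginv_r @ginv_mulK @gmul_invK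
  @ginv_mul @ginvK @ginv_one : grp.
Ltac grp := autorewrite with grp; auto.

Definition commute {G : Group} (x y : G) : Prop := gmul x y = gmul y x.

Lemma commute_sym {G : Group} (x y : G) : commute x y -> commute y x.
Proof. unfold commute. auto. Qed.

Lemma commute_mul {G : Group} (x y z : G) :
  commute x y -> commute x z -> commute x (gmul y z).
Proof.
  unfold commute. intros E F. now rewrite gassoc, E, gassoc', F, gassoc.
Qed.

Lemma commute_inv {G : Group} (x y : G) : commute x y -> commute x (ginv y).
Proof.
  unfold commute. intros E. apply (gmul_cancel_l y), (gmul_cancel_r y).
  grp.
Qed.

Lemma commute_one {G : Group} (x : G) : commute x gone.
Proof. unfold commute. grp. Qed.

Definition conjg {G : Group} (g x : G) : G := gmul g (gmul x (ginv g)).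

Lemma conj_mul {G : Group} (g x y : G) : conjg g (gmul x y) = gmul (conjg g x) (conjg g y).
Proof. unfold conjg. grp. Qed.

Lemma conj_inv {G : Group} (g x : G) : conjg g (ginv x) = ginv (conjg g x).
Proof. unfold conjg. grp. Qed.

Lemma conj_one {G : Group} (g : G) : conjg g gone = gone.
Proof. unfold conjg. grp. Qed.

Lemma conj_conj {G : Group} (g h x : G) : conjg g (conjg h x) = conjg (gmul g h) x.
Proof. unfold conjg. grp. Qed.

Lemma conjK {G : Group} (g x : G) : conjg (ginv g) (conjg g x) = x.
Proof. unfold conjg. grp. Qed.

Lemma conjVK {G : Group} (g x : G) : conjg g (conjg (ginv g) x) = x.
Proof. unfold conjg. grp. Qed.

Lemma conj_eq_one {G : Group} (g x : G) : conjg g x = gone -> x = gone.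
Proof. intros E. rewrite <- (conjK g x), E. apply conj_one. Qed.

Lemma commute_conj {G : Group} (g x y : G) : commute x y -> commute (conjg g x) (conjg g y).
Proof. unfold commute. intros E. now rewrite <- !conj_mul, E. Qed.

Lemma conj_fix {G : Group} (g x : G) : conjg g x = x <-> commute g x.
Proof.
  unfold conjg, commute. split; intros E.
  - rewrite <- E at 2. grp.
  - rewrite gassoc, E. grp.
Qed.

Lemma gpow_add {G : Group} (g : G) (m n : nat) :
  gpow g (m + n) = gmul (gpow g m) (gpow g n).
Proof. induction m; simpl; grp. now rewrite IHm. Qed.

Lemma gpow_one {G : Group} (n : nat) : gpow (gone : G) n = gone.
Proof. induction n; simpl; grp. Qed.

Lemma gpow_mul {G : Group} (g : G) (m n : nat) : gpow g (m * n) = gpow (gpow g m) n.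
Proof.
  induction n; simpl.
  - now rewrite Nat.mul_0_r.
  - now rewrite Nat.mul_succ_r, Nat.add_comm, gpow_add, IHn.
Qed.

Lemma commute_gpow {G : Group} (x y : G) (n : nat) : commute x y -> commute x (gpow y n).
Proof.
  intros E. induction n; simpl; [apply commute_one|now apply commute_mul].
Qed.

Lemma conj_gpow {G : Group} (g x : G) (n : nat) : conjg g (gpow x n) = gpow (conjg g x) n.
Proof. induction n; simpl; [apply conj_one|now rewrite conj_mul, IHn]. Qed.

Lemma gpow_inj {G : Group} (tf : torsion_free G) (v : G) (m n : nat) :
  v <> gone -> gpow v m = gpow v n -> m = n.
Proof.
  intros nv.
  assert (W : forall m n, (m < n)%nat -> gpow v m <> gpow v n).
  { intros a b L E. apply nv, (tf v (b - a)%nat); [lia|].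
    apply (gmul_cancel_l (gpow v a)). rewrite <- gpow_add, gone_r.
    now replace (a + (b - a))%nat with b by lia. }
  intros E. destruct (Nat.lt_trichotomy m n) as [L|[L|L]]; auto.
  - now destruct (W _ _ L).
  - now destruct (W _ _ L).
Qed.

Lemma gpow_neq_one {G : Group} (tf : torsion_free G) (v : G) (n : nat) :
  v <> gone -> (0 < n)%nat -> gpow v n <> gone.
Proof. intros nv L E. apply nv. eauto. Qed.

Definition zpow {G : Group} (g : G) (z : Z) : G :=
  match z with
  | Z0 => gone
  | Zpos p => gpow g (Pos.to_nat p)
  | Zneg p => ginv (gpow g (Pos.to_nat p))
  end.

Lemma zpow_of_nat {G : Group} (g : G) (n : nat) : zpow g (Z.of_nat n) = gpow g n.
Proof. destruct n; simpl; auto. now rewrite SuccNat2Pos.id_succ. Qed.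

Lemma zpow_opp_of_nat {G : Group} (g : G) (n : nat) :
  zpow g (- Z.of_nat n) = ginv (gpow g n).
Proof. destruct n; simpl; [now rewrite ginv_one|]. now rewrite SuccNat2Pos.id_succ. Qed.

Lemma gpow_sub {G : Group} (g : G) (m n : nat) :
  gmul (gpow g m) (ginv (gpow g n)) = zpow g (Z.of_nat m - Z.of_nat n).
Proof.
  destruct (le_ge_dec m n) as [L|L].
  - replace n with ((n - m) + m)%nat at 1 by lia. rewrite gpow_add, ginv_mul, gmul_invK.
    rewrite <- zpow_opp_of_nat. f_equal. lia.
  - replace m with ((m - n) + n)%nat at 1 by lia. rewrite gpow_add. grp.
    rewrite <- zpow_of_nat. f_equal. lia.
Qed.

Lemma zpow_split {G : Group} (g : G) (z : Z) :
  exists m n, z = (Z.of_nat m - Z.of_nat n)%Z.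
Proof.
  exists (Z.to_nat z), (Z.to_nat (- z)). lia.
Qed.

Lemma zpow_add {G : Group} (g : G) (a b : Z) :
  zpow g (a + b) = gmul (zpow g a) (zpow g b).
Proof.
  destruct (zpow_split g a) as [m [n ->]], (zpow_split g b) as [p [q ->]].
  replace (Z.of_nat m - Z.of_nat n + (Z.of_nat p - Z.of_nat q))%Z
    with (Z.of_nat (m + p) - Z.of_nat (n + q))%Z by lia.
  rewrite <- !gpow_sub, !gpow_add, ginv_mul, !gassoc'. f_equal.
  assert (C : commute (ginv (gpow g n)) (gmul (gpow g p) (ginv (gpow g q)))).
  { assert (P : forall i j, commute (gpow g i) (gpow g j)).
    { intros i j. apply commute_gpow, commute_sym, commute_gpow. reflexivity. }
    apply commute_mul.
    - apply commute_sym, commute_inv, P.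
    - apply commute_inv, commute_sym, commute_inv, P. }
  now rewrite C, !gassoc'.
Qed.

Lemma zpow_1 {G : Group} (g : G) : zpow g 1 = g.
Proof. simpl. grp. Qed.

Lemma zpow_opp {G : Group} (g : G) (a : Z) : zpow g (- a) = ginv (zpow g a).
Proof.
  apply ginv_unique. rewrite <- zpow_add. now rewrite Z.add_opp_diag_r.
Qed.

Lemma commute_zpow {G : Group} (x y : G) (z : Z) : commute x y -> commute x (zpow y z).
Proof.
  intros E. destruct z; simpl; [apply commute_one| |apply commute_inv]; now apply commute_gpow.
Qed.

Lemma conj_zpow {G : Group} (g x : G) (z : Z) : conjg g (zpow x z) = zpow (conjg g x) z.
Proof. destruct z; simpl; rewrite ?conj_inv, ?conj_gpow; auto. apply conj_one. Qed.

Lemma zpow_mul {G : Group} (g : G) (a b : Z) : zpow g (a * b) = zpow (zpow g a) b.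
Proof.
  assert (W : forall n : nat, zpow g (a * Z.of_nat n) = zpow (zpow g a) (Z.of_nat n)).
  { induction n.
    - now rewrite Z.mul_0_r.
    - rewrite Nat2Z.inj_succ. unfold Z.succ.
      rewrite Z.mul_add_distr_l, !zpow_add, IHn, Z.mul_1_r, zpow_1. auto. }
  destruct (Z.le_ge_cases 0 b) as [L|L].
  - rewrite <- (Z2Nat.id b L). apply W.
  - replace b with (- Z.of_nat (Z.to_nat (- b)))%Z by lia.
    rewrite Z.mul_opp_r, !zpow_opp. now rewrite W.
Qed.

Lemma zpow_eq_one {G : Group} (tf : torsion_free G) (v : G) (z : Z) :
  v <> gone -> zpow v z = gone -> z = 0%Z.
Proof.
  intros nv. destruct z; simpl; auto; intros E; exfalso.
  - apply (gpow_neq_one tf v (Pos.to_nat p)); auto. lia.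
  - apply (gpow_neq_one tf v (Pos.to_nat p)); auto. lia. now apply ginv_one_iff.
Qed.

Lemma zpow_inj {G : Group} (tf : torsion_free G) (v : G) (a b : Z) :
  v <> gone -> zpow v a = zpow v b -> a = b.
Proof.
  intros nv E. assert (zpow v (a - b) = gone).
  { unfold Z.sub. rewrite zpow_add, zpow_opp, E. apply ginv_r. }
  apply zpow_eq_one in H; auto. lia.
Qed.

Lemma finite_enum {T : Type} (P : T -> Prop) :
  finite_set P -> exists s, NoDup s /\ forall x, In x s <-> P x.
Proof.
  intros [l Hl].
  exists (nodup (fun x y => excluded_middle_informative (x = y))
           (filter (fun x => if excluded_middle_informative (P x) then true else false) l)).
  split; [apply NoDup_nodup|]. intros x. rewrite nodup_In, filter_In.
  destruct (excluded_middle_informative (P x)); split; try tauto; try (now intros []).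
  intros _. split; auto.
Qed.

Lemma NoDup_length_rel {T U : Type} (s : list T) (ts : list U) (Rel : T -> U -> Prop) :
  NoDup s -> (forall x, In x s -> exists t, In t ts /\ Rel x t) ->
  (forall x y t, In x s -> In y s -> Rel x t -> Rel y t -> x = y) ->
  (length s <= length ts)%nat.
Proof.
  intros nd cov inj.
  destruct s as [|x0 s0]; [simpl; lia|]. set (s := x0 :: s0) in *.
  destruct (cov x0) as [t0 _]; [now left|].
  set (f := fun x => epsilon (inhabits t0) (fun t => In t ts /\ Rel x t)).
  assert (Hf : forall x, In x s -> In (f x) ts /\ Rel x (f x)).
  { intros x Hx. apply (epsilon_spec (inhabits t0) (fun t => In t ts /\ Rel x t)). auto. }
  rewrite <- (length_map f s). apply NoDup_incl_length.
  - apply NoDup_map_NoDup_ForallPairs; auto. intros x y Hx Hy E.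
    apply (inj x y (f x)); auto; [now apply Hf|]. rewrite E. now apply Hf.
  - intros t Ht. apply in_map_iff in Ht as [x [<- Hx]]. now apply Hf.
Qed.

Lemma NoDup_length_classes {T U : Type} (s : list T) (ts : list U) (Rel : T -> U -> Prop)
  (m : nat) :
  NoDup s -> (forall x, In x s -> exists t, In t ts /\ Rel x t) ->
  (forall t s', NoDup s' -> incl s' s -> (forall x, In x s' -> Rel x t) -> (length s' <= m)%nat) ->
  (length s <= length ts * m)%nat.
Proof.
  revert s. induction ts as [|t ts IH]; intros s nd cov bd.
  - destruct s; simpl; [lia|]. destruct (cov t) as [? [[] _]]. now left.
  - set (p := fun x => if excluded_middle_informative (Rel x t) then true else false).
    assert (E : (length (filter p s) + length (filter (fun x => negb (p x)) s) = length s)%nat)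
      by apply filter_length.
    assert (L1 : (length (filter p s) <= m)%nat).
    { apply (bd t); [now apply NoDup_filter|apply incl_filter|].
      intros x Hx. apply filter_In in Hx as [_ Hx]. unfold p in Hx.
      now destruct (excluded_middle_informative (Rel x t)). }
    assert (L2 : (length (filter (fun x => negb (p x)) s) <= length ts * m)%nat).
    { apply IH; [now apply NoDup_filter| |].
      - intros x Hx. apply filter_In in Hx as [Hx Hp].
        destruct (cov x Hx) as [u [[<-|Hu] Ru]]; [|now exists u].
        unfold p in Hp. destruct (excluded_middle_informative (Rel x t)); [discriminate|tauto].
      - intros u s' nd' inc Hs'. apply (bd u); auto.
        intros x Hx. apply (incl_filter _ _ _ (inc x Hx)). }
    simpl. lia.
Qed.

(** * Centralizers with a finite-index cyclic subgroup *)

Definition sumZ (l : list Z) : Z := fold_right Z.add 0%Z l.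

Lemma sumZ_add {T : Type} (f g : T -> Z) (l : list T) :
  sumZ (map (fun t => (f t + g t)%Z) l) = (sumZ (map f l) + sumZ (map g l))%Z.
Proof. induction l; simpl; lia. Qed.

Lemma sumZ_perm (l l' : list Z) : Permutation l l' -> sumZ l = sumZ l'.
Proof. induction 1; simpl; lia. Qed.

Lemma coset_reps {G : Group} (v : G) (fs : list G) :
  exists ts, NoDup ts /\ (forall t, In t ts -> commute v t) /\
    (forall t t' k, In t ts -> In t' ts -> t = gmul t' (zpow v k) -> t = t') /\
    (forall f, In f fs -> commute v f -> exists t k, In t ts /\ f = gmul t (zpow v k)).
Proof.
  induction fs as [|f fs [ts (nd & cv & ineq & cov)]].
  - exists nil. repeat split; try constructor; simpl; tauto.
  - destruct (classic (commute v f)) as [cf|ncf].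
    2:{ exists ts. repeat split; auto. intros f' [<-|H] C; [tauto|auto]. }
    destruct (classic (exists t k, In t ts /\ f = gmul t (zpow v k))) as [Y|N].
    + exists ts. repeat split; auto. intros f' [<-|H] C; auto.
    + exists (f :: ts). repeat split.
      * constructor; auto. intros H. apply N. exists f, 0%Z. split; auto. simpl. now grp.
      * intros t [<-|H]; auto.
      * intros t t' k [<-|H] [<-|H'] E; auto.
        -- destruct N. now exists t', k.
        -- destruct N. exists t, (- k)%Z. split; auto. rewrite E, gassoc', <- zpow_add.
           replace (k + - k)%Z with 0%Z by lia. simpl. now grp.
        -- eauto.
      * intros f' [<-|H] C.
        -- exists f, 0%Z. split; [now left|]. simpl. now grp.
        -- destruct (cov f' H C) as [t [k [Ht E]]]. exists t, k. split; [now right|auto].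
Qed.

Definition cyclic_finite_index {G : Group} (v : G) (M : G -> Prop) : Prop :=
  exists fs : list G, forall g, M g -> exists f k, In f fs /\ g = gmul f (zpow v k).

(* The transfer homomorphism from the centralizer of [v] to the finite-index
   central subgroup generated by [v]; torsion-freeness makes it injective. *)
Lemma transfer {G : Group} (tf : torsion_free G) (v : G) :
  v <> gone -> cyclic_finite_index v (commute v) ->
  exists V : G -> Z,
    (forall g h, commute v g -> commute v h -> V (gmul g h) = (V g + V h)%Z) /\
    (forall g, commute v g -> V g = 0%Z -> g = gone).
Proof.
  intros nv [fs Hfs].
  destruct (coset_reps v fs) as [ts (nd & cv & ineq & cov0)].
  assert (cov : forall g, commute v g -> exists t k, In t ts /\ g = gmul t (zpow v k)).
  { intros g C. destruct (Hfs g C) as [f [k [Hf E]]].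
    destruct (cov0 f Hf) as [t [k' [Ht E']]].
    - replace f with (gmul g (ginv (zpow v k))) by (rewrite E; grp).
      apply commute_mul; auto. apply commute_inv, commute_zpow. reflexivity.
    - exists t, (k' + k)%Z. split; auto. rewrite zpow_add, gassoc, <- E'. auto. }
  clear fs Hfs cov0.
  set (Rl := fun g t (p : G * Z) => In (fst p) ts /\ gmul g t = gmul (fst p) (zpow v (snd p))).
  set (tc := fun g t => epsilon (inhabits (gone, 0%Z)) (Rl g t)).
  assert (Htc : forall g t, commute v g -> In t ts -> Rl g t (tc g t)).
  { intros g t C Ht. apply epsilon_spec.
    destruct (cov (gmul g t)) as [t' [k [Ht' E]]]; [now apply commute_mul; auto|].
    now exists (t', k). }
  assert (uniq : forall g t p q, Rl g t p -> Rl g t q -> p = q).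
  { intros g t [p1 p2] [q1 q2] [Hp Ep] [Hq Eq]; simpl in *.
    assert (p1 = q1).
    { apply (ineq p1 q1 (q2 - p2)%Z); auto. unfold Z.sub.
      rewrite zpow_add, gassoc, <- Eq, Ep, zpow_opp. grp. }
    subst q1. f_equal. apply (zpow_inj tf v); auto. apply (gmul_cancel_l p1). congruence. }
  set (V := fun g => sumZ (map (fun t => snd (tc g t)) ts)).
  assert (add : forall g h, commute v g -> commute v h -> V (gmul g h) = (V g + V h)%Z).
  { intros g h Cg Ch. unfold V.
    transitivity (sumZ (map (fun t => (snd (tc g (fst (tc h t))) + snd (tc h t))%Z) ts)).
    - f_equal. apply map_ext_in. intros t Ht.
      destruct (Htc h t Ch Ht) as [H1 E1].
      destruct (Htc g _ Cg H1) as [H2 E2].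
      rewrite (uniq (gmul g h) t (tc (gmul g h) t)
                (fst (tc g (fst (tc h t))), (snd (tc g (fst (tc h t))) + snd (tc h t))%Z)); auto.
      + apply Htc; auto. now apply commute_mul.
      + split; simpl; auto. rewrite gassoc', E1, gassoc, E2, gassoc', <- zpow_add. auto.
    - rewrite (sumZ_add (fun t => snd (tc g (fst (tc h t))))). f_equal.
      rewrite <- (map_map (fun t => fst (tc h t)) (fun t => snd (tc g t))).
      apply sumZ_perm, Permutation_map, NoDup_Permutation_bis.
      + apply NoDup_map_NoDup_ForallPairs; auto. intros t t' Ht Ht' E.
        destruct (Htc h t Ch Ht) as [_ E1], (Htc h t' Ch Ht') as [_ E2].
        apply (ineq t t' (snd (tc h t) - snd (tc h t'))%Z); auto.
        apply (gmul_cancel_l h). rewrite E1, gassoc, E2, E, gassoc', <- zpow_add.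
        f_equal. f_equal. lia.
      + now rewrite length_map.
      + intros t Ht. apply in_map_iff in Ht as [t' [<- Ht']]. now apply Htc. }
  assert (Cv : commute v v) by reflexivity.
  assert (Vone : V gone = 0%Z).
  { assert (E := add gone gone (commute_one v) (commute_one v)). rewrite gone_l in E. lia. }
  assert (Vpow : forall g n, commute v g -> V (gpow g n) = (Z.of_nat n * V g)%Z).
  { intros g n C. induction n as [|n IH]; [auto|]. simpl gpow.
    rewrite add, IH; auto; [lia|now apply commute_gpow]. }
  assert (Vv : V v = Z.of_nat (length ts)).
  { unfold V. transitivity (sumZ (map (fun _ => 1%Z) ts)).
    - f_equal. apply map_ext_in. intros t Ht.
      rewrite (uniq v t (tc v t) (t, 1%Z)); auto.
      split; auto. simpl fst; simpl snd. rewrite zpow_1. now apply cv.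
    - clear. induction ts as [|t ts IH]; auto.
      change (1 + sumZ (map (fun _ => 1%Z) ts) = Z.of_nat (S (length ts)))%Z. lia. }
  assert (tpos : (0 < length ts)%nat).
  { destruct (cov gone (commute_one v)) as [t [_ [Ht _]]]. destruct ts; [easy|simpl; lia]. }
  exists V. split; auto. intros g C Vg.
  assert (P : exists i j k, (i < j)%nat /\ gpow g j = gmul (gpow g i) (zpow v k)).
  { apply NNPP. intros N.
    assert (L : (length (seq 0 (S (length ts))) <= length ts)%nat).
    { apply (NoDup_length_rel _ ts (fun i t => exists k, gpow g i = gmul t (zpow v k))).
      - apply seq_NoDup.
      - intros i _. destruct (cov (gpow g i)) as [t [k [Ht E]]]; [now apply commute_gpow|].
        eauto.
      - intros i j t _ _ [k E] [k' E'].
        destruct (Nat.lt_trichotomy i j) as [L|[L|L]]; auto; destruct N.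
        + exists i, j, (k' - k)%Z. split; auto.
          rewrite E, E', gassoc', <- zpow_add. f_equal. f_equal. lia.
        + exists j, i, (k - k')%Z. split; auto.
          rewrite E, E', gassoc', <- zpow_add. f_equal. f_equal. lia. }
    rewrite length_seq in L. lia. }
  destruct P as (i & j & k & L & E).
  assert (Ek : gpow g (j - i) = zpow v k).
  { apply (gmul_cancel_l (gpow g i)). rewrite <- E, <- gpow_add. f_equal. lia. }
  assert (k = 0%Z).
  { assert (E' : V (gpow g (j - i)) = 0%Z) by (rewrite Vpow, Vg; auto; lia).
    rewrite Ek in E'. destruct k as [|p|p]; auto; exfalso; simpl in E'.
    - rewrite Vpow, Vv in E'; auto. lia.
    - assert (F := add (gpow v (Pos.to_nat p)) (ginv (gpow v (Pos.to_nat p)))).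
      rewrite ginv_r, Vone, E', Vpow, Vv in F; auto.
      assert (commute v (gpow v (Pos.to_nat p))) by now apply commute_gpow.
      specialize (F H (commute_inv _ _ H)). lia. }
  subst k. apply (tf g (j - i)%nat); [lia|]. now rewrite Ek.
Qed.

Definition centralizers_small (G : Group) : Prop :=
  forall v : G, v <> gone -> cyclic_finite_index v (commute v).

Lemma commute_trans {G : Group} (tf : torsion_free G) (cs : centralizers_small G) (v a b : G) :
  v <> gone -> commute v a -> commute v b -> commute a b.
Proof.
  intros nv Ca Cb. destruct (transfer tf v nv (cs v nv)) as [V [add inj]].
  assert (C1 := commute_mul _ _ _ Ca Cb). assert (C2 := commute_mul _ _ _ Cb Ca).
  assert (C3 := commute_inv _ _ C2).
  assert (E : gmul (gmul a b) (ginv (gmul b a)) = gone).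
  { apply inj; [now apply commute_mul|].
    assert (E1 := add _ _ Ca Cb). assert (E2 := add _ _ Cb Ca).
    assert (E3 := add _ _ C2 C3). rewrite ginv_r in E3.
    assert (E4 := add _ _ (commute_one v) (commute_one v)). rewrite gone_l in E4.
    rewrite (add _ _ C1 C3). lia. }
  unfold commute. apply (gmul_cancel_r (ginv (gmul b a))). now rewrite E, ginv_r.
Qed.

Lemma centralizer_cyclic {G : Group} (tf : torsion_free G) (cs : centralizers_small G) (v : G) :
  v <> gone -> exists a, commute v a /\ forall g, commute v g -> exists k, g = zpow a k.
Proof.
  intros nv. destruct (transfer tf v nv (cs v nv)) as [V [add inj]].
  assert (Vone : V gone = 0%Z).
  { assert (E := add gone gone (commute_one v) (commute_one v)). rewrite gone_l in E. lia. }
  assert (Vinv : forall g, commute v g -> V (ginv g) = (- V g)%Z).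
  { intros g C. assert (E := add _ _ C (commute_inv _ _ C)). rewrite ginv_r in E. lia. }
  assert (Vpow : forall g n, commute v g -> V (gpow g n) = (Z.of_nat n * V g)%Z).
  { intros g n C. induction n as [|n IH]; [auto|]. simpl gpow.
    rewrite add, IH; auto; [lia|now apply commute_gpow]. }
  assert (Vz : forall g z, commute v g -> V (zpow g z) = (z * V g)%Z).
  { intros g z C. destruct z; cbn [zpow]; auto.
    - rewrite Vpow; auto. lia.
    - rewrite Vinv, Vpow; auto; [lia|now apply commute_gpow]. }
  assert (Cv : commute v v) by reflexivity.
  set (P := fun n => (0 < n)%nat /\ exists g, commute v g /\ V g = Z.of_nat n).
  destruct (dec_inh_nat_subset_has_unique_least_element P) as [n [[[n0 [a [Ca Va]]] least] _]].
  { intros n. apply classic. }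
  { assert (V v <> 0%Z) by (intros E; now apply nv, inj).
    destruct (Z.lt_ge_cases 0 (V v)).
    - exists (Z.to_nat (V v)). split; [lia|]. exists v. split; auto. lia.
    - exists (Z.to_nat (- V v)). split; [lia|]. exists (ginv v).
      split; [now apply commute_inv|]. rewrite Vinv; auto. lia. }
  exists a. split; auto. intros g Cg. exists (V g / Z.of_nat n)%Z.
  set (q := (V g / Z.of_nat n)%Z).
  assert (Cq : commute v (ginv (zpow a q))) by now apply commute_inv, commute_zpow.
  assert (Er : V (gmul g (ginv (zpow a q))) = (V g mod Z.of_nat n)%Z).
  { rewrite add, <- zpow_opp, Vz, Va; auto. unfold q. rewrite Z.mod_eq by lia. lia. }
  assert (Z.of_nat n > 0)%Z by lia.
  assert (B := Z_mod_lt (V g) (Z.of_nat n) H).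
  assert (V g mod Z.of_nat n = 0)%Z.
  { apply NNPP. intros N.
    assert (n <= Z.to_nat (V g mod Z.of_nat n))%nat; [|lia].
    apply least. split; [lia|]. exists (gmul g (ginv (zpow a q))).
    split; [now apply commute_mul|]. rewrite Er. lia. }
  rewrite H0 in Er. apply inj in Er; [|now apply commute_mul].
  rewrite <- (gone_l G (zpow a q)), <- Er. grp.
Qed.

Lemma commute_of_conj {G : Group} (tf : torsion_free G) (cs : centralizers_small G) (z g : G) :
  z <> gone -> commute z (conjg g z) -> commute z g.
Proof.
  intros nz C.
  destruct (centralizer_cyclic tf cs z nz) as [a [Ca gen]].
  destruct (gen z) as [p Ep]; [reflexivity|].
  assert (na : a <> gone).
  { intros ->. apply nz. rewrite Ep. destruct p; simpl; rewrite ?gpow_one, ?ginv_one; auto. }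
  assert (K : forall h, commute z (conjg h z) -> exists k, conjg h a = zpow a k).
  { intros h Ch. apply gen. apply (commute_trans tf cs (conjg h z)).
    - intros E. now apply conj_eq_one in E.
    - now apply commute_sym.
    - now apply commute_conj. }
  assert (C' : commute z (conjg (ginv g) z)).
  { apply (commute_conj (ginv g)) in C. rewrite conjK in C. now apply commute_sym. }
  destruct (K g C) as [k Ek], (K _ C') as [l El].
  assert (kl : (k * l = 1)%Z).
  { apply (zpow_inj tf a); auto. rewrite zpow_mul, <- Ek, <- conj_zpow, <- El, conjVK, zpow_1.
    auto. }
  apply commute_sym. rewrite Ep. apply commute_zpow, conj_fix.
  assert (k = 1 \/ k = -1)%Z as [->| ->].
  { assert (Hk : (k | 1)%Z) by (exists l; lia). apply Z.divide_1_r in Hk. exact Hk. }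
  { now rewrite Ek, zpow_1. }
  destruct (classic (gmul g g = gone)) as [E|N].
  - assert (g = gone) as ->; [|now apply conj_fix, commute_sym, commute_one].
    apply (tf g 2%nat); [lia|]. simpl. now grp.
  - apply conj_fix, (commute_trans tf cs (gmul g g)); auto.
    + unfold commute. apply gassoc'.
    + apply conj_fix. rewrite <- conj_conj, Ek. change (-1)%Z with (- (1))%Z.
      rewrite zpow_opp, zpow_1, conj_inv, Ek. change (-1)%Z with (- (1))%Z.
      now rewrite zpow_opp, zpow_1, ginvK.
Qed.

Definition cyclic (G : Group) : Prop := exists a : G, forall g, exists k, g = zpow a k.

Lemma cyclic_of_commensurated {G : Group} (tf : torsion_free G) (cs : centralizers_small G)
  (z : G) (S : G -> Prop) :
  z <> gone -> (forall g, gen S g) -> (forall s, S s -> commute z (conjg s z)) -> cyclic G.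
Proof.
  intros nz HS HC. destruct (centralizer_cyclic tf cs z nz) as [a [_ H]].
  exists a. intros g. apply H. induction (HS g).
  - apply commute_of_conj; auto.
  - apply commute_one.
  - now apply commute_mul.
  - now apply commute_inv.
Qed.

Lemma cyclic_iso {G1 G2 : Group} :
  torsion_free G1 -> torsion_free G2 -> cyclic G1 -> cyclic G2 ->
  (exists x : G1, x <> gone) -> (exists x : G2, x <> gone) -> group_iso G1 G2.
Proof.
  intros tf1 tf2 [a Ha] [b Hb] [x nx] [y ny].
  assert (na : a <> gone).
  { intros ->. destruct (Ha x) as [k ->]. apply nx.
    destruct k; simpl; rewrite ?gpow_one, ?ginv_one; auto. }
  assert (nb : b <> gone).
  { intros ->. destruct (Hb y) as [k ->]. apply ny.
    destruct k; simpl; rewrite ?gpow_one, ?ginv_one; auto. }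
  set (ea := fun g => epsilon (inhabits 0%Z) (fun k => g = zpow a k)).
  set (eb := fun g => epsilon (inhabits 0%Z) (fun k => g = zpow b k)).
  assert (Ea : forall g, g = zpow a (ea g)) by (intros g; exact (epsilon_spec _ _ (Ha g))).
  assert (Eb : forall g, g = zpow b (eb g)) by (intros g; exact (epsilon_spec _ _ (Hb g))).
  exists (fun g => zpow b (ea g)), (fun g => zpow a (eb g)).
  split; [|split].
  - intros g h. rewrite <- zpow_add. f_equal. apply (zpow_inj tf1 a); auto.
    now rewrite zpow_add, <- !Ea.
  - intros g. rewrite (Ea g) at 2. f_equal. apply (zpow_inj tf2 b); auto.
  - intros g. rewrite (Eb g) at 2. f_equal. apply (zpow_inj tf1 a); auto.
Qed.

Lemma nilpotent_center {G : Group} (G0 : G -> Prop) :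
  nilpotent_mod G0 (fun x => x = gone) -> subgroup G0 -> (exists w, G0 w /\ w <> gone) ->
  exists z, z <> gone /\ G0 z /\ forall w, G0 w -> commute z w.
Proof.
  intros [c Hc] [S1 [Sm Si]] [w [Hw nw]].
  assert (sub : forall k x, lcs G0 k x -> G0 x).
  { induction k; simpl; auto. induction 1; auto.
    destruct H as (u & v & Hu & Hv & ->). unfold comm. auto 10. }
  revert Hc. induction c as [|c IH]; intros Hc.
  - destruct nw. now apply Hc.
  - destruct (classic (exists z, lcs G0 c z /\ z <> gone)) as [[z [Hz nz]]|N].
    + exists z. split; auto. split; [eauto|]. intros v Hv.
      assert (E : comm z v = gone).
      { apply Hc. simpl. apply gen_base. eauto. }
      unfold comm in E. unfold commute.
      apply (gmul_cancel_l (ginv v)), (gmul_cancel_l (ginv z)). rewrite E. now grp.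
    + apply IH. intros x Hx. apply NNPP. intros nx. apply N. eauto.
Qed.

Lemma finite_subgroup_trivial {G : Group} (tf : torsion_free G) (L : G -> Prop) :
  subgroup L -> finite_set L -> forall x, L x -> x = gone.
Proof.
  intros [S1 [Sm Si]] [l Hl] x Hx. apply NNPP. intros nx.
  assert (P : forall n, L (gpow x n)) by (induction n; simpl; auto).
  assert (H : (length (seq 0 (S (length l))) <= length l)%nat).
  { rewrite <- (length_map (gpow x)). apply NoDup_incl_length.
    - apply NoDup_map_NoDup_ForallPairs; [|apply seq_NoDup].
      intros i j _ _. now apply gpow_inj.
    - intros y Hy. apply in_map_iff in Hy as [i [<- _]]. auto. }
  rewrite length_seq in H. lia.
Qed.

(** * Four-point hyperbolic length functions *)

Definition ldist {G : Group} (l : G -> R) (x y : G) : R := l (gmul (ginv x) y).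

(* The length function [g |-> d x (act g x)] of an action whose orbits are
   [E/2]-dense in a hyperbolic geodesic space: [hl_four] is the four-point
   inequality, [hl_coarse] approximates the points of a geodesic from [1] to [g]. *)
Record hyp_length {G : Group} (l : G -> R) (delta E : R) : Prop := {
  hl_delta : 0 < delta;
  hl_E : 0 < E;
  hl_one : l gone = 0;
  hl_inv : forall g, l (ginv g) = l g;
  hl_mul : forall g h, l (gmul g h) <= l g + l h;
  hl_four : forall x y z w,
    ldist l x z + ldist l y w <= ldist l x y + ldist l z w + 2 * delta \/
    ldist l x z + ldist l y w <= ldist l y z + ldist l x w + 2 * delta;
  hl_coarse : forall g t, 0 <= t <= l g ->
    exists h, l h <= t + E /\ ldist l h g <= l g - t + E;
  hl_proper : forall r, finite_set (fun g => l g <= r)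
}.
Arguments hl_delta {G l delta E} _.
Arguments hl_E {G l delta E} _.
Arguments hl_one {G l delta E} _.
Arguments hl_inv {G l delta E} _ _.
Arguments hl_mul {G l delta E} _ _ _.
Arguments hl_four {G l delta E} _ _ _ _ _.
Arguments hl_coarse {G l delta E} _ _ _ _.
Arguments hl_proper {G l delta E} _ _.

Lemma ldist_left {G : Group} (l : G -> R) (g x y : G) :
  ldist l (gmul g x) (gmul g y) = ldist l x y.
Proof. unfold ldist. f_equal. grp. Qed.

Lemma ldist_one {G : Group} (l : G -> R) (x : G) : ldist l gone x = l x.
Proof. unfold ldist. f_equal. grp. Qed.

Section Geometry.
Context {G : Group} {l : G -> R} {delta E : R} (H : hyp_length l delta E).

Lemma hl_nonneg (g : G) : 0 <= l g.
Proof.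
  assert (A := hl_mul H g (ginv g)). rewrite ginv_r, hl_one, hl_inv in A by apply H. lra.
Qed.

Lemma ldist_sym (x y : G) : ldist l x y = ldist l y x.
Proof. unfold ldist. rewrite <- (hl_inv H). f_equal. grp. Qed.

Lemma ldist_tri (x y z : G) : ldist l x z <= ldist l x y + ldist l y z.
Proof.
  unfold ldist. replace (gmul (ginv x) z) with (gmul (gmul (ginv x) y) (gmul (ginv y) z)) by grp.
  apply (hl_mul H).
Qed.

Lemma ldist_gpow (u : G) (m n : nat) : ldist l (gpow u m) (gpow u (m + n)) = l (gpow u n).
Proof. unfold ldist. f_equal. rewrite gpow_add. grp. Qed.

Lemma l_gpow_1 (u : G) : l (gpow u 1) = l u.
Proof. simpl. now rewrite gone_r. Qed.

Lemma lox_step (u : G) (b : nat) :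
  l (gpow u 2) > l u + 3 * delta ->
  l (gpow u b) + (l (gpow u 2) - l u - 2 * delta) <= l (gpow u (S b)).
Proof.
  intros lox. assert (dp := hl_delta H). induction b as [|b IH].
  - assert (A := hl_mul H u u). simpl in *. rewrite !gone_r, (hl_one H) in *. lra.
  - assert (F := hl_four H (gpow u 0) (gpow u (S (S b))) (gpow u 2) (gpow u 1)).
    rewrite (ldist_sym (gpow u (S (S b)))), (ldist_sym (gpow u 2)),
      (ldist_sym (gpow u (S (S b)))) in F.
    assert (E1 := ldist_gpow u 0 2). assert (E2 := ldist_gpow u 1 (S b)).
    assert (E3 := ldist_gpow u 0 (S (S b))). assert (E4 := ldist_gpow u 1 1).
    assert (E5 := ldist_gpow u 2 b). assert (E6 := ldist_gpow u 0 1).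
    cbn [Nat.add] in *. rewrite E1, E2, E3, E4, E5, E6, l_gpow_1 in F. lra.
Qed.

Lemma lox_grow (u : G) (b : nat) :
  l (gpow u 2) > l u + 3 * delta -> INR b * delta <= l (gpow u b).
Proof.
  intros lox. induction b as [|b IH].
  - simpl. rewrite (hl_one H). lra.
  - assert (A := lox_step u b lox). rewrite S_INR. lra.
Qed.

(* The constant is twice the Gromov product of [u] and its inverse, up to delta. *)
Definition lox_defect (u : G) : R := 2 * l u - l (gpow u 2) + 4 * delta.

Lemma lox_defect_nonneg (u : G) : 0 <= lox_defect u.
Proof.
  unfold lox_defect. assert (A := hl_mul H u u). assert (B := hl_delta H).
  simpl. rewrite gone_r. lra.
Qed.

Lemma lox_super (u : G) (a b : nat) :
  l (gpow u 2) > l u + 3 * delta ->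
  l (gpow u a) + l (gpow u b) - lox_defect u <= l (gpow u (a + b)).
Proof.
  intros lox. assert (dp := hl_delta H). destruct a as [|a].
  - assert (A := lox_defect_nonneg u). simpl gpow at 1. rewrite (hl_one H). simpl Nat.add. lra.
  - assert (F := hl_four H (gpow u a) (gpow u 0) (gpow u (a + S b)) (gpow u (S a))).
    rewrite (ldist_sym (gpow u a) (gpow u 0)), (ldist_sym (gpow u (a + S b))) in F.
    assert (E1 := ldist_gpow u a (S b)). assert (E2 := ldist_gpow u 0 (S a)).
    assert (E3 := ldist_gpow u 0 a). assert (E4 := ldist_gpow u (S a) b).
    assert (E5 := ldist_gpow u 0 (a + S b)). assert (E6 := ldist_gpow u a 1).
    replace (a + 1)%nat with (S a) in E6 by lia.
    replace (S a + b)%nat with (a + S b)%nat in * by lia. cbn [Nat.add] in *.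
    rewrite E1, E2, E3, E4, E5, E6, l_gpow_1 in F.
    assert (A := lox_step u a lox). assert (B := lox_step u b lox).
    unfold lox_defect. lra.
Qed.

(* [u^k g] lies near a geodesic from [1] to [u^2k]: translating that geodesic by [g]
   moves its far away endpoints by [l g] only. *)
Lemma lox_centralizer_mid (u g : G) :
  l (gpow u 2) > l u + 3 * delta -> commute u g ->
  exists k, l (gmul (gpow u k) g) + ldist l (gmul (gpow u k) g) (gpow u (k + k))
            <= l (gpow u (k + k)) + lox_defect u + 4 * delta.
Proof.
  intros lox Cg. assert (dp := hl_delta H).
  destruct (INR_archimed delta (4 * l g + lox_defect u + 4 * delta) dp) as [k Hk].
  exists k. assert (A := lox_grow u k lox). assert (B := lox_super u k k lox).
  assert (C := lox_defect_nonneg u). assert (N := hl_nonneg g).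
  set (f := gmul (gpow u k) g).
  assert (Cp : forall n, gmul (gpow u n) g = gmul g (gpow u n)).
  { intros n. symmetry. apply commute_gpow. now apply commute_sym. }
  assert (D1 : ldist l g f = l (gpow u k)).
  { unfold f. rewrite Cp. rewrite <- (gone_r g) at 1. now rewrite ldist_left, ldist_one. }
  assert (D2 : ldist l f (gmul g (gpow u (k + k))) = l (gpow u k)).
  { unfold f. rewrite Cp, ldist_left. apply ldist_gpow. }
  assert (D3 : ldist l g (gmul g (gpow u (k + k))) = l (gpow u (k + k))).
  { rewrite <- (gone_r g) at 1. now rewrite ldist_left, ldist_one. }
  assert (D4 : ldist l (gpow u (k + k)) (gmul g (gpow u (k + k))) = l g).
  { unfold ldist. rewrite <- Cp. f_equal. grp. }
  assert (D5 : ldist l (gpow u k) f = l g).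
  { unfold f, ldist. f_equal. grp. }
  assert (D6 := ldist_gpow u k k).
  assert (D7 : ldist l gone g = l g) by apply ldist_one.
  assert (D8 : ldist l gone f = l f) by apply ldist_one.
  assert (D9 : ldist l gone (gpow u (k + k)) = l (gpow u (k + k))) by apply ldist_one.
  assert (D0 : ldist l gone (gpow u k) = l (gpow u k)) by apply ldist_one.
  fold f.
  assert (T1 := ldist_tri (gpow u k) f (gpow u (k + k))).
  assert (T2 := ldist_tri gone f (gpow u k)). rewrite (ldist_sym f (gpow u k)) in T2.
  assert (T3 := ldist_tri gone g (gpow u (k + k))).
  assert (F1 := hl_four H f g (gpow u (k + k)) (gmul g (gpow u (k + k)))).
  assert (F2 := hl_four H f g gone (gpow u (k + k))).
  rewrite (ldist_sym f g) in F1, F2. rewrite (ldist_sym f gone), (ldist_sym g gone) in F2.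
  lra.
Qed.

Lemma discrete_crossing (P Q : nat -> Prop) (n : nat) :
  (forall j, (j <= n)%nat -> P j \/ Q j) -> Q O -> P n ->
  exists j j', Q j /\ P j' /\ (j' <= n)%nat /\ (j' = j \/ j' = S j).
Proof.
  intros D Q0 Pn. induction n as [|n IH].
  - exists O, O. auto.
  - destruct (D n) as [L|R]; [lia| |].
    + destruct IH as (j & j' & X); auto. exists j, j'. intuition lia.
    + exists n, (S n). auto 10.
Qed.

Lemma lox_centralizer (u g : G) :
  l (gpow u 2) > l u + 3 * delta -> commute u g ->
  exists k j, l (gmul (ginv (gpow u j)) (gmul (gpow u k) g))
              <= l u + 3 * lox_defect u + 8 * delta.
Proof.
  intros lox Cg. destruct (lox_centralizer_mid u g lox Cg) as [k Hk].
  assert (dp := hl_delta H). exists k. set (f := gmul (gpow u k) g) in *.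
  set (n := (k + k)%nat) in *. set (C := lox_defect u) in *.
  assert (C0 : 0 <= C) by apply lox_defect_nonneg.
  destruct (discrete_crossing
    (fun j => (j <= n)%nat -> ldist l (gpow u j) f + l (gpow u (n - j)) - C
              <= ldist l f (gpow u n) + 2 * delta)
    (fun j => ldist l (gpow u j) f + l (gpow u j) - C <= l f + 2 * delta) n)
    as (j & j' & Q & P & Ln & J).
  - intros j Lj.
    assert (F := hl_four H (gpow u j) gone f (gpow u n)).
    assert (S := lox_super u j (n - j) lox). fold C in S.
    replace (j + (n - j))%nat with n in S by lia.
    assert (X := ldist_gpow u j (n - j)). replace (j + (n - j))%nat with n in X by lia.
    rewrite (ldist_sym (gpow u j) gone), !ldist_one, X in F. lra.
  - change (gpow u 0) with (gone : G). rewrite ldist_one, (hl_one H). lra.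
  - intros _. rewrite Nat.sub_diag. change (gpow u 0) with (gone : G). rewrite (hl_one H), (ldist_sym f). lra.
  - exists j. specialize (P Ln). fold (ldist l (gpow u j) f).
    assert (U := hl_nonneg u).
    assert (Y : l (gpow u n) <= l (gpow u j) + l u + l (gpow u (n - j'))).
    { destruct J as [-> | ->].
      - replace n with (j + (n - j))%nat at 1 by lia. rewrite gpow_add.
        assert (A := hl_mul H (gpow u j) (gpow u (n - j))). lra.
      - replace n with (j + (1 + (n - S j)))%nat at 1 by lia. rewrite gpow_add.
        assert (A := hl_mul H (gpow u j) (gpow u (1 + (n - S j)))).
        assert (B := hl_mul H u (gpow u (n - S j))). simpl gpow in *. lra. }
    assert (Z := hl_nonneg (gmul (ginv (gpow u j')) f)). fold (ldist l (gpow u j') f) in Z.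
    lra.
Qed.

(* Four-point inequalities along the path [1, a, ab, aab, aabb]: if [ab] is long, then so are
   [aab] and [abb], and hence the square [aabb] of [ab]. *)
Lemma nonlox_mul (a b : G) :
  commute a b -> l (gpow (gmul a b) 2) <= l (gmul a b) + 3 * delta ->
  l (gmul a b) <= Rmax (l a) (l b) + 5 * delta.
Proof.
  intros C NL. assert (dp := hl_delta H).
  assert (M1 := Rmax_l (l a) (l b)). assert (M2 := Rmax_r (l a) (l b)).
  set (M := Rmax (l a) (l b)) in *.
  destruct (Rle_dec (l (gmul a b)) (M + delta)) as [L|N]; [lra|apply Rnot_le_lt in N].
  pose (P0 := gone : G). pose (P1 := a). pose (P2 := gmul a b).
  pose (P3 := gmul a (gmul a b)). pose (P4 := gmul a (gmul a (gmul b b))).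
  assert (D01 : ldist l P0 P1 = l a) by apply ldist_one.
  assert (D12 : ldist l P1 P2 = l b) by (unfold P1, P2, ldist; f_equal; grp).
  assert (D23 : ldist l P2 P3 = l a).
  { unfold P2, P3. rewrite ldist_left. unfold ldist. f_equal. rewrite C. grp. }
  assert (D34 : ldist l P3 P4 = l b).
  { unfold P3, P4. rewrite !ldist_left. unfold ldist. f_equal. grp. }
  assert (D02 : ldist l P0 P2 = l (gmul a b)) by apply ldist_one.
  assert (D13 : ldist l P1 P3 = l (gmul a b)) by (unfold P1, P3, ldist; f_equal; grp).
  assert (D24 : ldist l P2 P4 = l (gmul a b)).
  { unfold P2, P4. rewrite ldist_left. unfold ldist. f_equal.
    rewrite (gassoc G a b b), C. grp. }
  assert (D04 : ldist l P0 P4 <= l (gmul a b) + 3 * delta).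
  { unfold P0. rewrite ldist_one. replace P4 with (gpow (gmul a b) 2); auto.
    unfold P4. simpl. grp. f_equal. rewrite gassoc, <- C. grp. }
  assert (F1 := hl_four H P0 P1 P2 P3).
  assert (F2 := hl_four H P1 P2 P3 P4).
  assert (F3 := hl_four H P0 P1 P3 P4).
  assert (X14 := ldist_sym P1 P4). lra.
Qed.

Lemma nonlox_descent (a b : G) (T k t : R) (m : G) :
  l a <= T -> T - k < l a -> l b <= T ->
  ldist l a b <= T + 5 * delta -> l (gmul a b) <= T + 5 * delta -> commute a b ->
  l m <= t + E -> ldist l m a <= l a - t + E -> 2 * t + k <= T ->
  2 * t = 2 * E + 9 * delta + k -> 2 * k + 2 * E + 9 * delta <= T ->
  ldist l m (gmul b m) <= T - k.
Proof.
  intros. assert (dp := hl_delta H). assert (Ep := hl_E H).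
  assert (E1 : ldist l a (gmul a b) = l b) by (unfold ldist; f_equal; grp).
  assert (E2 : ldist l b (gmul a b) = l a).
  { rewrite H5. unfold ldist; f_equal; grp. }
  assert (E3 : ldist l b (gmul b m) = l m) by (unfold ldist; f_equal; grp).
  assert (E4 : ldist l (gmul b m) (gmul a b) = ldist l m a).
  { rewrite H5. apply ldist_left. }
  assert (F1 := hl_four H m gone b a).
  assert (F2 := hl_four H m gone (gmul a b) a).
  rewrite (ldist_sym m gone), !ldist_one, (ldist_sym b a) in F1.
  rewrite (ldist_sym m gone), !ldist_one, (ldist_sym (gmul a b) a), E1 in F2.
  assert (F3 := hl_four H m b (gmul b m) (gmul a b)).
  rewrite E2, E3, E4 in F3. lra.
Qed.

End Geometry.

(* Moving the base point along the longest displacement shortens all long displacements,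
   as the elements with long displacement all point in the same direction. *)
Lemma common_almost_fixed_point {G : Group} {l : G -> R} {delta E : R}
  (H : hyp_length l delta E) (v : G) (N : nat) :
  (forall p y, l (gpow (conjg y (gpow v p)) 2) <= l (conjg y (gpow v p)) + 3 * delta) ->
  exists y, forall p, (p <= N)%nat -> l (conjg y (gpow v p)) <= 2 * E + 11 * delta.
Proof.
  intros NL. assert (dp := hl_delta H). assert (Ep := hl_E H).
  set (C0 := 2 * E + 11 * delta).
  assert (desc : forall n T y, T <= C0 + INR n * delta ->
    (forall p, (p <= N)%nat -> l (conjg y (gpow v p)) <= T) ->
    exists y', forall p, (p <= N)%nat -> l (conjg y' (gpow v p)) <= C0).
  { induction n as [|n IH]; intros T y LT HT.
    - exists y. intros p Lp. specialize (HT p Lp). simpl in LT. lra.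
    - rewrite S_INR in LT. destruct (Rle_dec T C0) as [L|L].
      { exists y. intros p Lp. specialize (HT p Lp). lra. }
      apply Rnot_le_lt in L.
      destruct (classic (exists i, (i <= N)%nat /\ T - delta < l (conjg y (gpow v i))))
        as [[i [Li Hi]]|NE].
      + set (a := conjg y (gpow v i)) in *.
        set (t := E + 5 * delta).
        destruct (hl_coarse H a t) as [m [M1 M2]]; [unfold t, C0 in *; lra|].
        apply (IH (T - delta) (gmul (ginv m) y)); [lra|].
        intros j Lj. set (b := conjg y (gpow v j)).
        replace (l (conjg (gmul (ginv m) y) (gpow v j))) with (ldist l m (gmul b m))
          by (unfold ldist, b, conjg; f_equal; grp).
        assert (Cab : commute a b).
        { apply commute_conj, commute_gpow, commute_sym, commute_gpow. reflexivity. }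
        assert (Eab : gmul a b = conjg y (gpow v (i + j))).
        { unfold a, b. now rewrite <- conj_mul, gpow_add. }
        apply (nonlox_descent H a b T delta t m); auto; unfold t, C0 in *; try lra.
        * apply HT; auto.
        * apply HT; auto.
        * assert (ldist l a b <= T); [|lra].
          destruct (le_ge_dec i j) as [Lij|Lij].
          -- replace (ldist l a b) with (l (conjg y (gpow v (j - i)))); [apply HT; lia|].
             unfold ldist. f_equal. unfold a, b. rewrite <- conj_inv, <- conj_mul. f_equal.
             replace j with (i + (j - i))%nat at 2 by lia. rewrite gpow_add. grp.
          -- rewrite (ldist_sym H).
             replace (ldist l b a) with (l (conjg y (gpow v (i - j)))); [apply HT; lia|].
             unfold ldist. f_equal. unfold a, b. rewrite <- conj_inv, <- conj_mul. f_equal.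
             replace i with (j + (i - j))%nat at 2 by lia. rewrite gpow_add. grp.
        * assert (X : l (gmul a b) <= Rmax (l a) (l b) + 5 * delta).
          { apply (nonlox_mul H); auto. rewrite Eab. apply NL. }
          assert (Rmax (l a) (l b) <= T) by (apply Rmax_lub; apply HT; auto). lra.
      + apply (IH (T - delta) y); [lra|]. intros p Lp.
        destruct (Rle_dec (l (conjg y (gpow v p))) (T - delta)); auto.
        destruct NE. exists p. split; auto. lra. }
  assert (bd : exists T, forall p, (p <= N)%nat -> l (conjg gone (gpow v p)) <= T).
  { clear. induction N as [|N [T HT]].
    - exists (l (conjg gone (gpow v 0))). intros p Lp. replace p with 0%nat by lia. lra.
    - exists (Rmax T (l (conjg gone (gpow v (S N))))). intros p Lp.
      assert (A := Rmax_l T (l (conjg gone (gpow v (S N))))).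
      assert (B := Rmax_r T (l (conjg gone (gpow v (S N))))).
      destruct (le_lt_dec p N) as [L|L]; [specialize (HT p L); lra|].
      replace p with (S N) by lia. lra. }
  destruct bd as [T HT]. destruct (INR_archimed delta (T - C0) dp) as [n Hn].
  apply (desc n T gone); auto. lra.
Qed.

Lemma exists_lox {G : Group} {l : G -> R} {delta E : R}
  (H : hyp_length l delta E) (tf : torsion_free G) (v : G) :
  v <> gone -> exists p y, l (gpow (conjg y (gpow v p)) 2) > l (conjg y (gpow v p)) + 3 * delta.
Proof.
  intros nv. apply NNPP. intros N.
  destruct (hl_proper H (2 * E + 11 * delta)) as [s Hs].
  destruct (common_almost_fixed_point H v (length s)) as [y Hy].
  { intros p y. apply Rnot_lt_le. intros L. apply N. exists p, y. lra. }
  assert (L : (length (seq 0 (S (length s))) <= length s)%nat).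
  { rewrite <- (length_map (fun p => conjg y (gpow v p))). apply NoDup_incl_length.
    - apply NoDup_map_NoDup_ForallPairs; [|apply seq_NoDup].
      intros i j _ _ E'. apply (gpow_inj tf v); auto.
      rewrite <- (conjK y (gpow v i)), E'. apply conjK.
    - intros x Hx. apply in_map_iff in Hx as [p [<- Hp]]. apply in_seq in Hp.
      apply Hs, Hy. lia. }
  rewrite length_seq in L. lia.
Qed.

Lemma hyp_centralizers_small {G : Group} {l : G -> R} {delta E : R}
  (H : hyp_length l delta E) : torsion_free G -> centralizers_small G.
Proof.
  intros tf v nv. destruct (exists_lox H tf v nv) as [p [y lox]].
  set (u := conjg y (gpow v p)) in *.
  destruct (hl_proper H (l u + 3 * lox_defect (l := l) (delta := delta) u + 8 * delta))
    as [s Hs].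
  exists (map (conjg (ginv y)) s). intros g Cg.
  assert (Cu : commute u (conjg y g)).
  { apply commute_conj, commute_sym, commute_gpow, commute_sym, Cg. }
  destruct (lox_centralizer H u (conjg y g) lox Cu) as [k [j L]].
  set (f := gmul (ginv (gpow u j)) (gmul (gpow u k) (conjg y g))) in *.
  exists (conjg (ginv y) f), (Z.of_nat (p * j) - Z.of_nat (p * k))%Z.
  split; [now apply in_map, Hs|].
  unfold f, u. rewrite <- !conj_gpow, <- !gpow_mul, <- conj_inv, <- !conj_mul, conjK.
  rewrite <- gpow_sub.
  assert (P : forall n, commute g (gpow v n)).
  { intros n. now apply commute_gpow, commute_sym. }
  assert (Q : commute (gpow v (p * j)) (gpow v (p * k))).
  { apply commute_gpow, commute_sym, commute_gpow. reflexivity. }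
  assert (R : commute g (gmul (gpow v (p * j)) (ginv (gpow v (p * k))))).
  { apply commute_mul; [apply P|apply commute_inv, P]. }
  rewrite !gassoc', R, (gassoc G (gpow v (p * k))), (gassoc G (gpow v (p * k))), <- Q. grp.
Qed.

(** * Growth of balls *)

Definition Rsum {T : Type} (f : T -> R) (s : list T) : R :=
  fold_right (fun x a => f x + a) 0 s.

Lemma Rsum_le {T : Type} (f g : T -> R) (s : list T) :
  (forall x, In x s -> f x <= g x) -> Rsum f s <= Rsum g s.
Proof.
  induction s as [|x s IH]; simpl; intros L; [lra|].
  assert (A := L x (or_introl eq_refl)). assert (B := IH (fun y Hy => L y (or_intror Hy))). lra.
Qed.

Lemma Rsum_ext {T : Type} (f g : T -> R) (s : list T) :
  (forall x, In x s -> f x = g x) -> Rsum f s = Rsum g s.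
Proof. intros L. apply Rle_antisym; apply Rsum_le; intros x Hx; rewrite L; auto; lra. Qed.

Lemma Rsum_plus {T : Type} (f g : T -> R) (s : list T) :
  Rsum (fun x => f x + g x) s = Rsum f s + Rsum g s.
Proof. induction s; simpl; lra. Qed.

Lemma Rsum_scal {T : Type} (c : R) (f : T -> R) (s : list T) :
  Rsum (fun x => c * f x) s = c * Rsum f s.
Proof. induction s; simpl; lra. Qed.

Lemma Rsum_const {T : Type} (c : R) (s : list T) :
  Rsum (fun _ => c) s = c * INR (length s).
Proof.
  induction s; [simpl; lra|]. change (c + Rsum (fun _ => c) s = c * INR (S (length s))).
  rewrite S_INR. lra.
Qed.

Lemma Rsum_map {T U : Type} (h : T -> U) (f : U -> R) (s : list T) :
  Rsum f (map h s) = Rsum (fun x => f (h x)) s.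
Proof. induction s; simpl; congruence. Qed.

Lemma Rsum_filter {T : Type} (p : T -> bool) (f : T -> R) (s : list T) :
  Rsum (fun x => if p x then f x else 0) s = Rsum f (filter p s).
Proof. induction s as [|x s IH]; simpl; auto. destruct (p x); simpl; lra. Qed.

Lemma Rsum_swap {T U : Type} (f : T -> U -> R) (s : list T) (t : list U) :
  Rsum (fun x => Rsum (f x) t) s = Rsum (fun y => Rsum (fun x => f x y) s) t.
Proof.
  induction s as [|x s IH]; simpl.
  - rewrite Rsum_const. lra.
  - now rewrite Rsum_plus, IH.
Qed.

Lemma Rsum_app {T : Type} (f : T -> R) (s t : list T) :
  Rsum f (s ++ t) = Rsum f s + Rsum f t.
Proof. induction s; simpl; lra. Qed.

Lemma Rsum_incl {T : Type} (f : T -> R) (s t : list T) :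
  NoDup s -> incl s t -> (forall x, 0 <= f x) -> Rsum f s <= Rsum f t.
Proof.
  intros nd inc pos. revert t inc. induction nd as [|x s nx nd IH]; intros t inc.
  - simpl. clear inc. induction t as [|y t IHt]; simpl; [lra|]. specialize (pos y). lra.
  - destruct (in_split x t) as [t1 [t2 ->]]; [apply inc; now left|].
    assert (A : Rsum f s <= Rsum f (t1 ++ t2)).
    { apply IH. intros y Hy. assert (B := inc y (or_intror Hy)).
      apply in_app_iff in B as [B|[<-|B]]; apply in_app_iff; tauto. }
    rewrite Rsum_app in *. simpl. lra.
Qed.

Definition ball {G : Group} (l : G -> R) (r : R) : list G :=
  epsilon (inhabits nil) (fun s => NoDup s /\ forall g, In g s <-> l g <= r).

Definition bcard {G : Group} (l : G -> R) (r : R) : R := INR (length (ball l r)).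

(* The hypothesis [entropy_le] at the base point of the length [l]. *)
Definition growth_le {G : Group} (l : G -> R) (h : R) : Prop :=
  forall eps, 0 < eps -> forall R0, exists (Rr : R) (n : nat), R0 <= Rr /\ 0 < Rr /\
    has_card (fun g : G => l g < Rr) n /\ ln (INR n) / Rr <= h + eps.

Section Growth.
Context {G : Group} {l : G -> R} {delta E : R} (H : hyp_length l delta E).

Lemma ball_spec (r : R) : NoDup (ball l r) /\ forall g, In g (ball l r) <-> l g <= r.
Proof. unfold ball. apply epsilon_spec, finite_enum, (hl_proper H). Qed.

Lemma in_ball (r : R) (g : G) : In g (ball l r) <-> l g <= r.
Proof. apply ball_spec. Qed.

Lemma ball_NoDup (r : R) : NoDup (ball l r).
Proof. apply ball_spec. Qed.

Lemma length_le_ball (p : G) (s : list G) (r : R) :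
  NoDup s -> (forall h, In h s -> ldist l p h <= r) -> (length s <= length (ball l r))%nat.
Proof.
  intros nd L. rewrite <- (length_map (gmul (ginv p))). apply NoDup_incl_length.
  - apply NoDup_map_NoDup_ForallPairs; auto. intros x y _ _. apply gmul_cancel_l.
  - intros x Hx. apply in_map_iff in Hx as [h [<- Hh]]. now apply in_ball, L.
Qed.

Lemma bcard_mono (r r' : R) : r <= r' -> bcard l r <= bcard l r'.
Proof.
  intros L. apply le_INR, (length_le_ball gone); [apply ball_NoDup|].
  intros h Hh. apply in_ball in Hh. rewrite ldist_one. lra.
Qed.

Lemma bcard_pos (r : R) : 0 <= r -> 1 <= bcard l r.
Proof.
  intros L. change 1 with (INR (length (gone :: nil : list G))).
  apply le_INR, NoDup_incl_length.
  - constructor; [easy|constructor].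
  - intros x [<-|[]]. apply in_ball. now rewrite (hl_one H).
Qed.

Lemma bcard_submult (T : R) (n : nat) :
  E <= T -> bcard l (INR (S n) * T) <= bcard l (T + 2 * E) ^ S n.
Proof.
  intros LT. assert (Ep := hl_E H). induction n as [|n IH].
  - simpl. rewrite Rmult_1_l, Rmult_1_r. apply bcard_mono. lra.
  - apply Rle_trans with (bcard l (T + 2 * E) * bcard l (INR (S n) * T)).
    + unfold bcard. rewrite <- mult_INR. apply le_INR.
      apply (NoDup_length_classes _ _ (fun g h => ldist l h g <= INR (S n) * T)).
      * apply ball_NoDup.
      * intros g Hg. apply in_ball in Hg.
        destruct (Rle_dec (l g) (INR (S n) * T)) as [L|L].
        -- exists gone. split; [|now rewrite ldist_one].
           apply in_ball. rewrite (hl_one H). lra.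
        -- apply Rnot_le_lt in L. rewrite (S_INR (S n)) in Hg.
           assert (P := pos_INR n). rewrite (S_INR n) in *.
           destruct (hl_coarse H g (l g - (INR n + 1) * T + E)) as [h [A B]].
           ++ split; [lra|]. nra.
           ++ exists h. split; [apply in_ball|]; lra.
      * intros h s' nd _ Hs'. now apply (length_le_ball h).
    + change (bcard l (T + 2 * E) ^ S (S n)) with
        (bcard l (T + 2 * E) * bcard l (T + 2 * E) ^ S n).
      apply Rmult_le_compat_l; auto. apply pos_INR.
Qed.

Lemma exp_mul_INR (x : R) (n : nat) : exp x ^ n = exp (INR n * x).
Proof.
  induction n as [|n IH]; [simpl; now rewrite Rmult_0_l, exp_0|].
  rewrite S_INR, Rmult_plus_distr_r, exp_plus, <- IH, Rmult_1_l. simpl. lra.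
Qed.

Lemma bcard_exp (h : R) :
  0 < h -> growth_le l h ->
  exists T, 0 < T /\ forall n, bcard l (INR (S n) * T) <= exp (INR (S n) * (2 * h * T)).
Proof.
  intros hp gr. assert (Ep := hl_E H).
  destruct (gr (h / 2) ltac:(lra) (12 * E)) as [Rr [m [L [Rp [[s [nd [<- Hs]]] Hln]]]]].
  exists (Rr - 3 * E). split; [lra|]. intros n.
  apply Rle_trans with (bcard l (Rr - 3 * E + 2 * E) ^ S n); [apply bcard_submult; lra|].
  rewrite <- exp_mul_INR. apply pow_incr. split; [apply pos_INR|].
  assert (Lb : bcard l (Rr - 3 * E + 2 * E) <= INR (length s)).
  { apply le_INR, NoDup_incl_length; [apply ball_NoDup|].
    intros g Hg. apply in_ball in Hg. apply Hs. lra. }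
  assert (B := bcard_pos (Rr - 3 * E + 2 * E) ltac:(lra)).
  apply Rle_trans with (1 := Lb). rewrite <- (exp_ln (INR (length s))) by lra.
  assert (Hl : ln (INR (length s)) <= (h + h / 2) * Rr).
  { apply (Rmult_le_compat_r Rr) in Hln; [|lra]. unfold Rdiv in Hln at 1.
    rewrite Rmult_assoc, Rinv_l, Rmult_1_r in Hln; lra. }
  assert (X : ln (INR (length s)) <= 2 * h * (Rr - 3 * E)) by nra.
  destruct X as [X|X]; [left; now apply exp_increasing|right; now rewrite X].
Qed.

Lemma exp_le (x y : R) : x <= y -> exp x <= exp y.
Proof. intros [L|L]; [left; now apply exp_increasing|right; now rewrite L]. Qed.

Definition poincare (s T : R) : R := Rsum (fun g => exp (- s * l g)) (ball l T).

Lemma poincare_mono (s T T' : R) : T <= T' -> poincare s T <= poincare s T'.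
Proof.
  intros L. apply Rsum_incl; [apply ball_NoDup| |].
  - intros g Hg. apply in_ball in Hg. apply in_ball. lra.
  - intros g. left. apply exp_pos.
Qed.

Lemma poincare_shell (s T T' : R) :
  0 <= s -> poincare s T' <= poincare s T + exp (- s * T) * bcard l T'.
Proof.
  intros sp. set (p := fun g => if Rle_dec (l g) T then true else false).
  unfold poincare at 1.
  apply Rle_trans with (Rsum (fun g => (if p g then exp (- s * l g) else 0) + exp (- s * T))
                         (ball l T')).
  - apply Rsum_le. intros g _. unfold p. assert (A := exp_pos (- s * T)).
    destruct (Rle_dec (l g) T) as [L|L]; [lra|]. apply Rnot_le_lt in L.
    assert (exp (- s * l g) <= exp (- s * T)) by (apply exp_le; nra). lra.
  - rewrite Rsum_plus, Rsum_const, Rsum_filter. apply Rplus_le_compat_r.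
    apply Rsum_incl.
    + apply NoDup_filter, ball_NoDup.
    + intros g Hg. apply filter_In in Hg as [_ Hg]. unfold p in Hg. apply in_ball.
      now destruct (Rle_dec (l g) T).
    + intros g. left. apply exp_pos.
Qed.

Lemma poincare_bounded (h s : R) :
  0 < h -> growth_le l h -> 2 * h < s -> exists W, forall T, poincare s T <= W.
Proof.
  intros hp gr hs. destruct (bcard_exp h hp gr) as [T [Tp HT]].
  set (q := exp (- (s - 2 * h) * T)).
  assert (q0 : 0 < q) by apply exp_pos.
  assert (q1 : q < 1).
  { unfold q. rewrite <- exp_0. apply exp_increasing. nra. }
  set (A := exp (2 * h * T)). assert (Ap : 0 < A) by apply exp_pos.
  assert (B : forall n, poincare s (INR n * T) <= A * (1 + (1 - q ^ n) / (1 - q))).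
  { induction n as [|n IH].
    - simpl INR. rewrite Rmult_0_l. simpl pow.
      replace (A * (1 + (1 - 1) / (1 - q))) with A by (field; lra).
      apply Rle_trans with (bcard l 0).
      + unfold poincare, bcard. rewrite <- (Rmult_1_l (INR _)), <- Rsum_const. apply Rsum_le.
        intros g _. rewrite <- exp_0. apply exp_le. assert (N := hl_nonneg H g). nra.
      + apply Rle_trans with (bcard l (INR 1 * T)); [apply bcard_mono; simpl; lra|].
        assert (X := HT 0%nat). simpl INR in *. rewrite !Rmult_1_l in X. rewrite Rmult_1_l. exact X.
    - assert (X := poincare_shell s (INR n * T) (INR (S n) * T) ltac:(lra)).
      assert (Y := HT n).
      assert (Z : exp (- s * (INR n * T)) * bcard l (INR (S n) * T) <= A * q ^ n).
      { apply Rle_trans with (exp (- s * (INR n * T)) * exp (INR (S n) * (2 * h * T))).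
        - apply Rmult_le_compat_l; [left; apply exp_pos|exact Y].
        - right. unfold A, q. rewrite exp_mul_INR, <- !exp_plus, S_INR. f_equal. ring. }
      replace (A * (1 + (1 - q ^ S n) / (1 - q)))
        with (A * (1 + (1 - q ^ n) / (1 - q)) + A * q ^ n) by (simpl; field; lra).
      lra. }
  exists (A * (1 + 1 / (1 - q))). intros T'.
  destruct (INR_archimed T T' Tp) as [n Hn].
  apply Rle_trans with (poincare s (INR n * T)); [apply poincare_mono; lra|].
  apply Rle_trans with (1 := B n). apply Rmult_le_compat_l; [lra|].
  apply Rplus_le_compat_l. unfold Rdiv. apply Rmult_le_compat_r.
  - left. apply Rinv_0_lt_compat. lra.
  - assert (0 < q ^ n) by (now apply pow_lt). lra.
Qed.

(* The elements [h] of a ball for which [g h] is not much longer than [g] all lie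
   in a ball of about half the radius. *)
Lemma backward_ball (k : G) (R0 c : R) :
  0 <= c -> 2 * c <= R0 ->
  exists p, forall h, l h <= R0 -> ldist l k h < l k + 2 * c ->
    ldist l p h <= R0 / 2 + c + E + 2 * delta.
Proof.
  intros cp cR. assert (dp := hl_delta H). assert (Ep := hl_E H).
  set (t := R0 / 2 - c). destruct (Rle_dec t (l k)) as [L|L].
  - destruct (hl_coarse H k t) as [p [P1 P2]]; [unfold t in *; lra|].
    exists p. intros h Lh Lk.
    assert (F := hl_four H h gone p k).
    rewrite (ldist_sym H h gone), !ldist_one, (ldist_sym H h p), (ldist_sym H h k) in F.
    unfold t in *. lra.
  - exists k. intros h Lh Lk. apply Rnot_le_lt in L. unfold t in *. lra.
Qed.

Lemma backward_sum (g : G) (s R0 c : R) :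
  0 < s -> 0 <= c -> 2 * c <= R0 ->
  Rsum (fun h => exp (- s * l (gmul g h))) (ball l R0) <=
  exp (- s * l g) * (exp (- (2 * s * c)) * bcard l R0 +
                     exp (s * R0) * bcard l (R0 / 2 + c + E + 2 * delta)).
Proof.
  intros sp cp cR.
  set (p := fun h => if Rlt_dec (l (gmul g h)) (l g + 2 * c) then true else false).
  apply Rle_trans with (Rsum (fun h => exp (- s * l g) *
    (exp (- (2 * s * c)) + (if p h then exp (s * R0) else 0))) (ball l R0)).
  - apply Rsum_le. intros h Hh. apply in_ball in Hh. rewrite Rmult_plus_distr_l.
    assert (A := exp_pos (- s * l g)). assert (B := exp_pos (- (2 * s * c))).
    unfold p. destruct (Rlt_dec (l (gmul g h)) (l g + 2 * c)) as [L|L].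
    + assert (l g <= l (gmul g h) + R0).
      { assert (X := hl_mul H (gmul g h) (ginv h)). rewrite (hl_inv H) in X.
        replace (gmul (gmul g h) (ginv h)) with g in X by grp. lra. }
      assert (exp (- s * l (gmul g h)) <= exp (- s * l g) * exp (s * R0)).
      { rewrite <- exp_plus. apply exp_le. nra. }
      nra.
    + apply Rnot_lt_le in L.
      assert (exp (- s * l (gmul g h)) <= exp (- s * l g) * exp (- (2 * s * c))).
      { rewrite <- exp_plus. apply exp_le. nra. }
      lra.
  - rewrite Rsum_scal, Rsum_plus, Rsum_const, Rsum_filter, Rsum_const.
    apply Rmult_le_compat_l; [left; apply exp_pos|].
    apply Rplus_le_compat_l, Rmult_le_compat_l; [left; apply exp_pos|].
    destruct (backward_ball (ginv g) R0 c cp cR) as [q Hq].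
    apply le_INR, (length_le_ball q); [apply NoDup_filter, ball_NoDup|].
    intros h Hh. apply filter_In in Hh as [Hh Ph]. apply in_ball in Hh.
    apply Hq; auto. unfold ldist. rewrite ginvK, (hl_inv H). unfold p in Ph.
    now destruct (Rlt_dec (l (gmul g h)) (l g + 2 * c)).
Qed.

(* Summing [exp (- s * l (g h))] over all [g] gives the Poincare series for each [h];
   summing first over [h] in a ball gains a factor unless the half ball is large. *)
Lemma ball_ratio (h s R0 c : R) :
  0 < h -> growth_le l h -> 2 * h < s -> 0 <= c -> 2 * c <= R0 ->
  bcard l R0 * (1 - exp (- (2 * s * c))) <=
  exp (s * R0) * bcard l (R0 / 2 + c + E + 2 * delta).
Proof.
  intros hp gr hs cp cR.
  set (Y := exp (- (2 * s * c)) * bcard l R0 +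
            exp (s * R0) * bcard l (R0 / 2 + c + E + 2 * delta)).
  assert (Yp : 0 <= Y).
  { unfold Y. assert (A := exp_pos (- (2 * s * c))). assert (B := exp_pos (s * R0)).
    assert (C := pos_INR (length (ball l R0))).
    assert (D := pos_INR (length (ball l (R0 / 2 + c + E + 2 * delta)))).
    unfold bcard. nra. }
  assert (key : forall T, bcard l R0 * poincare s T <= poincare s (T + R0) * Y).
  { intros T.
    apply Rle_trans with (Rsum (fun h => Rsum (fun g => exp (- s * l (gmul g h)))
                            (ball l (T + R0))) (ball l R0)).
    - unfold bcard. rewrite Rmult_comm, <- Rsum_const. apply Rsum_le.
      intros k Hk. apply in_ball in Hk.
      apply Rle_trans with (Rsum (fun g => exp (- s * l (gmul g k)))
                             (map (fun g => gmul g (ginv k)) (ball l T))).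
      + rewrite Rsum_map. right. apply Rsum_ext. intros g _. do 3 f_equal. grp.
      + apply Rsum_incl.
        * apply NoDup_map_NoDup_ForallPairs; [|apply ball_NoDup].
          intros x y _ _. apply gmul_cancel_r.
        * intros x Hx. apply in_map_iff in Hx as [g [<- Hg]]. apply in_ball in Hg.
          apply in_ball. assert (A := hl_mul H g (ginv k)). rewrite (hl_inv H) in A. lra.
        * intros g. left. apply exp_pos.
    - rewrite Rsum_swap. unfold poincare. rewrite Rmult_comm, <- Rsum_scal.
      apply Rsum_le. intros g _. rewrite Rmult_comm. apply backward_sum; lra. }
  destruct (poincare_bounded h s hp gr hs) as [W HW].
  set (S := fun w => exists T, w = poincare s T).
  destruct (completeness S) as [w [ub lub]].
  { exists W. intros x [T ->]. apply HW. }
  { exists (poincare s 0). now exists 0. }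
  assert (wp : 0 < w).
  { apply Rlt_le_trans with (poincare s 0).
    - apply Rlt_le_trans with (Rsum (fun g => exp (- s * l g)) (gone :: nil)).
      + simpl. rewrite Rplus_0_r. apply exp_pos.
      + apply Rsum_incl.
        * constructor; [easy|constructor].
        * intros x [<-|[]]. apply in_ball. rewrite (hl_one H). lra.
        * intros g. left. apply exp_pos.
    - apply ub. now exists 0. }
  assert (bp : 1 <= bcard l R0) by (apply bcard_pos; lra).
  assert (L : w <= w * Y / bcard l R0).
  { apply lub. intros x [T ->].
    apply (Rmult_le_reg_l (bcard l R0)); [lra|].
    replace (bcard l R0 * (w * Y / bcard l R0)) with (w * Y) by (field; lra).
    apply Rle_trans with (1 := key T). apply Rmult_le_compat_r; auto. apply ub. now exists (T + R0). }
  assert (L' : bcard l R0 <= Y).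
  { apply (Rmult_le_compat_r (bcard l R0)) in L; [|lra].
    replace (w * Y / bcard l R0 * bcard l R0) with (w * Y) in L by (field; lra).
    apply (Rmult_le_reg_l w); lra. }
  unfold Y in L'. lra.
Qed.

Lemma one_minus_exp (x : R) : 0 <= x -> x / (1 + x) <= 1 - exp (- x).
Proof.
  intros xp. rewrite exp_Ropp. assert (A := exp_ineq1_le x).
  assert (B : / exp x <= / (1 + x)) by (apply Rinv_le_contravar; lra).
  replace (x / (1 + x)) with (1 - / (1 + x)) by (field; lra). lra.
Qed.

Lemma ball_doubling (h r : R) :
  0 < h -> growth_le l h -> 100 * (E + 2 * delta) <= r ->
  bcard l (2 * r) <= 243 * exp (8 * (h * r)) * bcard l r.
Proof.
  intros hp gr Lr. assert (dp := hl_delta H). assert (Ep := hl_E H).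
  set (s := 2 * h + 1 / (2 * r)).
  assert (rp : 0 < r) by lra.
  assert (sr : s * r = 2 * (h * r) + 1 / 2) by (unfold s; field; lra).
  assert (hr : 0 < h * r) by nra.
  assert (hs : 2 * h < s).
  { unfold s. assert (0 < 1 / (2 * r)); [|lra]. apply Rdiv_lt_0_compat; lra. }
  assert (A := ball_ratio h s (2 * r) (r / 2) hp gr hs ltac:(lra) ltac:(lra)).
  assert (B := ball_ratio h s (151 / 100 * r) (235 / 1000 * r) hp gr hs ltac:(lra) ltac:(lra)).
  assert (A' := bcard_mono (2 * r / 2 + r / 2 + E + 2 * delta) (151 / 100 * r) ltac:(lra)).
  assert (B' := bcard_mono (151 / 100 * r / 2 + 235 / 1000 * r + E + 2 * delta) r ltac:(lra)).
  replace (2 * s * (r / 2)) with (s * r) in A by field.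
  replace (2 * s * (235 / 1000 * r)) with (47 / 100 * (s * r)) in B by field.
  replace (s * (2 * r)) with (2 * (s * r)) in A by ring.
  replace (s * (151 / 100 * r)) with (151 / 100 * (s * r)) in B by ring.
  assert (U : 1 / 3 <= 1 - exp (- (s * r))).
  { assert (X := one_minus_exp (1 / 2) ltac:(lra)).
    assert (exp (- (s * r)) <= exp (- (1 / 2))) by (apply exp_le; lra). lra. }
  assert (V : 19 / 100 <= 1 - exp (- (47 / 100 * (s * r)))).
  { assert (X := one_minus_exp (235 / 1000) ltac:(lra)).
    assert (exp (- (47 / 100 * (s * r))) <= exp (- (235 / 1000))) by (apply exp_le; lra). lra. }
  assert (P1 := exp_pos (2 * (s * r))). assert (P2 := exp_pos (151 / 100 * (s * r))).
  assert (b0 := bcard_pos (2 * r) ltac:(lra)). assert (b1 := bcard_pos (151 / 100 * r) ltac:(lra)).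
  assert (b2 := bcard_pos r ltac:(lra)).
  assert (A2 : bcard l (2 * r) <= 3 * (exp (2 * (s * r)) * bcard l (151 / 100 * r))) by nra.
  assert (B2 : bcard l (151 / 100 * r) <= 100 / 19 * (exp (151 / 100 * (s * r)) * bcard l r))
    by nra.
  assert (M : exp (2 * (s * r)) * exp (151 / 100 * (s * r)) <= 9 * exp (8 * (h * r))).
  { rewrite <- exp_plus.
    apply Rle_trans with (exp (1 + (1 + 8 * (h * r)))); [apply exp_le; lra|].
    rewrite !exp_plus. assert (e3 := exp_le_3). assert (e0 := exp_pos 1).
    rewrite <- Rmult_assoc. apply Rmult_le_compat_r; [left; apply exp_pos|nra]. }
  apply Rle_trans with (3 * (exp (2 * (s * r)) *
    (100 / 19 * (exp (151 / 100 * (s * r)) * bcard l r)))).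
  - apply Rle_trans with (1 := A2). nra.
  - replace (3 * (exp (2 * (s * r)) * (100 / 19 * (exp (151 / 100 * (s * r)) * bcard l r))))
      with (300 / 19 * (exp (2 * (s * r)) * exp (151 / 100 * (s * r))) * bcard l r) by field.
    apply Rmult_le_compat_r; [lra|]. assert (e8 := exp_pos (8 * (h * r))). nra.
Qed.

End Growth.

(** * A ball determines the group *)

Section Extension.
Context {G : Group} {l : G -> R} {delta E : R} (H : hyp_length l delta E).
Context (rho : R) (Hrho : 2 * E + 4 * delta <= rho).

Lemma step_exists (g : G) : rho < l g ->
  exists h, l h <= l g - 2 * delta /\ ldist l h g <= rho / 2 + E /\
    forall k, l k <= l g -> ldist l g k <= rho -> ldist l h k <= rho.
Proof.
  intros L. assert (dp := hl_delta H). assert (Ep := hl_E H).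
  destruct (hl_coarse H g (l g - rho / 2)) as [h [A B]]; [lra|].
  exists h. split; [lra|]. split; [lra|]. intros k Lk Dk.
  assert (F := hl_four H h gone k g).
  rewrite (ldist_sym H h gone), !ldist_one, (ldist_sym H k g) in F. lra.
Qed.

Lemma ball_generates (g : G) : gen (fun s => l s <= rho) g.
Proof.
  assert (dp := hl_delta H). assert (Ep := hl_E H).
  assert (P : forall n g, l g <= INR n * (2 * delta) -> gen (fun s => l s <= rho) g).
  { intros n. induction n as [|n IH]; intros k Lk.
    - apply gen_base. simpl in Lk. lra.
    - destruct (Rle_dec (l k) rho) as [L|L]; [now apply gen_base|apply Rnot_le_lt in L].
      destruct (step_exists k L) as [h [A [B _]]].
      rewrite <- (gmul_invK h k). apply gen_mul.
      + apply IH. rewrite S_INR in Lk. lra.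
      + apply gen_base. unfold ldist in B. lra. }
  destruct (INR_archimed (2 * delta) (l g) ltac:(lra)) as [n Hn]. apply (P n). lra.
Qed.

Context {G' : Group} (f : G -> G').
Context (f_mul : forall a b, l a <= rho -> l b <= rho -> l (gmul a b) <= rho ->
  f (gmul a b) = gmul (f a) (f b)).

Definition geod_step (g : G) : G :=
  epsilon (inhabits gone) (fun h => l h <= l g - 2 * delta /\ ldist l h g <= rho / 2 + E /\
    forall k, l k <= l g -> ldist l g k <= rho -> ldist l h k <= rho).

Fixpoint ext_fuel (n : nat) (g : G) : G' :=
  match n with
  | O => f g
  | S n => if Rle_dec (l g) rho then f g
           else gmul (ext_fuel n (geod_step g)) (f (gmul (ginv (geod_step g)) g))
  end.

Lemma ext_fuel_stable (n m : nat) (g : G) :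
  l g <= rho + INR n * (2 * delta) -> (n <= m)%nat -> ext_fuel m g = ext_fuel n g.
Proof.
  assert (dp := hl_delta H). revert m g. induction n as [|n IH]; intros m g Lg Lm.
  - simpl in Lg. destruct m; simpl; auto. destruct (Rle_dec (l g) rho); auto. lra.
  - destruct m as [|m]; [lia|]. simpl. destruct (Rle_dec (l g) rho) as [L|L]; auto.
    f_equal. apply IH; [|lia]. apply Rnot_le_lt in L.
    destruct (epsilon_spec (inhabits gone) _ (step_exists g L)) as [A _].
    fold (geod_step g) in A. rewrite S_INR in Lg. lra.
Qed.

Definition ext (g : G) : G' :=
  ext_fuel (epsilon (inhabits O) (fun n => l g <= rho + INR n * (2 * delta))) g.

Lemma ext_eq (n : nat) (g : G) :
  l g <= rho + INR n * (2 * delta) -> ext g = ext_fuel n g.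
Proof.
  intros L. unfold ext.
  assert (S := epsilon_spec (inhabits O) (fun n => l g <= rho + INR n * (2 * delta))
                 (ex_intro _ n L)). simpl in S.
  destruct (le_ge_dec n (epsilon (inhabits O) (fun n => l g <= rho + INR n * (2 * delta)))).
  - now apply ext_fuel_stable.
  - symmetry. now apply ext_fuel_stable.
Qed.

Lemma ext_ball (g : G) : l g <= rho -> ext g = f g.
Proof. intros L. apply (ext_eq O). simpl. lra. Qed.

Lemma ext_step (g : G) :
  rho < l g -> ext g = gmul (ext (geod_step g)) (f (gmul (ginv (geod_step g)) g)).
Proof.
  intros L. assert (dp := hl_delta H).
  destruct (epsilon_spec (inhabits gone) _ (step_exists g L)) as [A _].
  fold (geod_step g) in A.
  destruct (INR_archimed (2 * delta) (l g) ltac:(lra)) as [n Hn].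
  assert (0 <= rho) by (assert (Ep := hl_E H); lra).
  rewrite (ext_eq (S n) g), (ext_eq n (geod_step g)); [|lra|rewrite S_INR; lra].
  simpl. destruct (Rle_dec (l g) rho); auto. lra.
Qed.

Lemma f_one : f gone = gone.
Proof.
  assert (dp := hl_delta H). assert (Ep := hl_E H).
  assert (A := f_mul gone gone). rewrite gone_l, (hl_one H) in A.
  apply (gmul_cancel_l (f gone)). rewrite gone_r. symmetry. apply A; lra.
Qed.

Lemma f_inv (a : G) : l a <= rho -> f (ginv a) = ginv (f a).
Proof.
  intros L. apply ginv_unique. rewrite <- f_mul; rewrite ?ginv_r, ?(hl_inv H); auto.
  - apply f_one.
  - rewrite (hl_one H). assert (dp := hl_delta H). assert (Ep := hl_E H). lra.
Qed.

(* Replacing the longer of [g] and [h] by the point half of [rho] closer to [1] keeps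
   their distance at most [rho] and lowers the total length. *)
Lemma ext_edge (g h : G) :
  ldist l g h <= rho -> ext h = gmul (ext g) (f (gmul (ginv g) h)).
Proof.
  assert (dp := hl_delta H). assert (Ep := hl_E H).
  assert (small : forall g h, l g <= rho -> l h <= rho -> ldist l g h <= rho ->
    ext h = gmul (ext g) (f (gmul (ginv g) h))).
  { intros a b La Lb D. rewrite !ext_ball, <- f_mul; auto; now rewrite gmul_invK. }
  assert (red : forall g h, rho < l g -> l h <= l g -> ldist l g h <= rho ->
    ext h = gmul (ext (geod_step g)) (f (gmul (ginv (geod_step g)) h)) ->
    ext h = gmul (ext g) (f (gmul (ginv g) h))).
  { intros a b La Lb D IH. rewrite IH, (ext_step a La).
    destruct (epsilon_spec (inhabits gone) _ (step_exists a La)) as (A & B & C).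
    fold (geod_step a) in A, B, C. rewrite gassoc'. f_equal.
    rewrite <- f_mul.
    - f_equal. now grp.
    - unfold ldist in B. lra.
    - exact D.
    - replace (gmul (gmul (ginv (geod_step a)) a) (gmul (ginv a) b))
        with (gmul (ginv (geod_step a)) b) by grp. now apply C. }
  assert (main : forall n g h, l g + l h <= INR n * (2 * delta) -> ldist l g h <= rho ->
    ext h = gmul (ext g) (f (gmul (ginv g) h))).
  { induction n as [|n IH]; intros a b Ls D.
    - simpl in Ls. assert (Na := hl_nonneg H a). assert (Nb := hl_nonneg H b).
      apply small; auto; lra.
    - rewrite S_INR in Ls.
      destruct (Rle_dec (l b) (l a)) as [Lba|Lba].
      + destruct (Rle_dec (l a) rho) as [La|La]; [apply small; auto; lra|].
        apply Rnot_le_lt in La. apply red; auto.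
        destruct (epsilon_spec (inhabits gone) _ (step_exists a La)) as (A & B & C).
        fold (geod_step a) in A, B, C. apply IH; [lra|auto].
      + apply Rnot_le_lt in Lba.
        destruct (Rle_dec (l b) rho) as [Lb|Lb]; [apply small; auto; lra|].
        apply Rnot_le_lt in Lb. rewrite (ldist_sym H) in D.
        assert (X : ext a = gmul (ext b) (f (gmul (ginv b) a))).
        { apply red; auto; [lra|].
          destruct (epsilon_spec (inhabits gone) _ (step_exists b Lb)) as (A & B & C).
          fold (geod_step b) in A, B, C. apply IH; [lra|]. apply C; auto. lra. }
        rewrite X. replace (gmul (ginv a) b) with (ginv (gmul (ginv b) a)) by grp.
        rewrite f_inv; auto. now grp. }
  intros D. destruct (INR_archimed (2 * delta) (l g + l h) ltac:(lra)) as [n Hn].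
  apply (main n); auto. lra.
Qed.

Lemma ball_hom_extends :
  exists Phi : G -> G', (forall x y, Phi (gmul x y) = gmul (Phi x) (Phi y)) /\
    forall a, l a <= rho -> Phi a = f a.
Proof.
  exists ext. split; [|apply ext_ball].
  assert (E1 : ext gone = gone).
  { rewrite ext_ball; [apply f_one|]. rewrite (hl_one H).
    assert (dp := hl_delta H). assert (Ep := hl_E H). lra. }
  assert (Es : forall x s, l s <= rho -> ext (gmul x s) = gmul (ext x) (ext s)).
  { intros x s Ls. rewrite (ext_ball s Ls), (ext_edge x (gmul x s)).
    - now rewrite ginv_mulK.
    - unfold ldist. now rewrite ginv_mulK. }
  intros x y. revert x. induction (ball_generates y) as [s Hs| |a b _ IHa _ IHb|a Ha IHa];
    intros x.
  - now apply Es.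
  - now rewrite E1, !gone_r.
  - now rewrite gassoc, IHb, IHa, IHb, gassoc'.
  - assert (Ia : ext (ginv a) = ginv (ext a)).
    { symmetry. apply gmul_cancel_r with (x := ext a). now rewrite <- IHa, !ginv_l. }
    rewrite Ia. apply gmul_cancel_r with (x := ext a). rewrite <- IHa. now grp.
Qed.

End Extension.

Lemma hom_id_of_gen {G : Group} (Psi : G -> G) (S : G -> Prop) :
  (forall x y, Psi (gmul x y) = gmul (Psi x) (Psi y)) -> (forall s, S s -> Psi s = s) ->
  forall g, gen S g -> Psi g = g.
Proof.
  intros hom fix_S.
  assert (E1 : Psi gone = gone).
  { apply (gmul_cancel_l (Psi gone)). now rewrite <- hom, !gone_r. }
  induction 1; auto.
  - now rewrite hom, IHgen1, IHgen2.
  - apply (gmul_cancel_l x). rewrite ginv_r, <- IHgen at 1. now rewrite <- hom, ginv_r.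
Qed.

Lemma ball_iso_extends {G1 G2 : Group} {l1 : G1 -> R} {l2 : G2 -> R} {delta E : R}
  (H1 : hyp_length l1 delta E) (H2 : hyp_length l2 delta E) (rho : R)
  (f1 : G1 -> G2) (f2 : G2 -> G1) :
  2 * E + 4 * delta <= rho ->
  (forall a, l1 a <= rho -> l2 (f1 a) <= rho /\ f2 (f1 a) = a) ->
  (forall a, l2 a <= rho -> l1 (f2 a) <= rho /\ f1 (f2 a) = a) ->
  (forall a b, l1 a <= rho -> l1 b <= rho -> l1 (gmul a b) <= rho ->
    f1 (gmul a b) = gmul (f1 a) (f1 b)) ->
  (forall a b, l2 a <= rho -> l2 b <= rho -> l2 (gmul a b) <= rho ->
    f2 (gmul a b) = gmul (f2 a) (f2 b)) ->
  group_iso G1 G2.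
Proof.
  intros Hr K1 K2 M1 M2.
  destruct (ball_hom_extends H1 rho Hr f1 M1) as [P1 [hom1 ext1]].
  destruct (ball_hom_extends H2 rho Hr f2 M2) as [P2 [hom2 ext2]].
  exists P1, P2. split; auto. split; intros x.
  - apply (hom_id_of_gen (fun x => P2 (P1 x)) (fun s => l1 s <= rho)).
    + intros a b. now rewrite hom1, hom2.
    + intros s Hs. destruct (K1 s Hs). now rewrite ext1, ext2.
    + now apply (ball_generates H1).
  - apply (hom_id_of_gen (fun x => P1 (P2 x)) (fun s => l2 s <= rho)).
    + intros a b. now rewrite hom2, hom1.
    + intros s Hs. destruct (K2 s Hs). now rewrite ext2, ext1.
    + now apply (ball_generates H2).
Qed.

Definition entry {G : Group} (e : list G) (i j k : nat) : Prop :=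
  (i < length e)%nat /\ (j < length e)%nat /\ (k < length e)%nat /\
  gmul (nth i e gone) (nth j e gone) = nth k e gone.

Definition triples (m : nat) : list (nat * nat * nat) :=
  list_prod (list_prod (seq 0 m) (seq 0 m)) (seq 0 m).

Definition table {G : Group} (e : list G) (m : nat) : list bool :=
  map (fun t : nat * nat * nat =>
    if excluded_middle_informative (entry e (fst (fst t)) (snd (fst t)) (snd t))
    then true else false) (triples m).

Lemma table_length {G : Group} (e : list G) (m : nat) : length (table e m) = (m ^ 3)%nat.
Proof.
  unfold table, triples. rewrite length_map, !length_prod, length_seq. simpl. lia.
Qed.

Lemma table_entry {G1 G2 : Group} (e1 : list G1) (e2 : list G2) (m : nat) :
  (length e1 <= m)%nat -> table e1 m = table e2 m ->
  forall i j k, entry e1 i j k -> entry e2 i j k.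
Proof.
  intros Lm T i j k En.
  assert (In (i, j, k) (triples m)).
  { destruct En as (? & ? & ? & _). repeat apply in_prod; apply in_seq; lia. }
  assert (X := ext_in_map T _ H). simpl in X.
  destruct (excluded_middle_informative (entry e1 i j k)); [|tauto].
  now destruct (excluded_middle_informative (entry e2 i j k)).
Qed.

Definition transport {G1 G2 : Group} (e1 : list G1) (e2 : list G2) (x : G1) : G2 :=
  nth (epsilon (inhabits O) (fun i => (i < length e1)%nat /\ nth i e1 gone = x)) e2 gone.

Lemma transport_nth {G1 G2 : Group} (e1 : list G1) (e2 : list G2) (i : nat) :
  NoDup e1 -> (i < length e1)%nat -> transport e1 e2 (nth i e1 gone) = nth i e2 gone.
Proof.
  intros nd L. unfold transport.
  destruct (epsilon_spec (inhabits O)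
    (fun j => (j < length e1)%nat /\ nth j e1 gone = nth i e1 gone)) as [A B].
  { now exists i. }
  f_equal. now apply (NoDup_nth e1 gone).
Qed.

Lemma table_iso {G1 G2 : Group} {l1 : G1 -> R} {l2 : G2 -> R} {delta E : R}
  (H1 : hyp_length l1 delta E) (H2 : hyp_length l2 delta E) (rho : R) (m : nat) :
  2 * E + 4 * delta <= rho ->
  (length (ball l1 rho) <= m)%nat -> (length (ball l2 rho) <= m)%nat ->
  table (ball l1 rho) m = table (ball l2 rho) m -> group_iso G1 G2.
Proof.
  intros Hr L1 L2 T. assert (dp := hl_delta H1). assert (Ep := hl_E H1).
  set (e1 := ball l1 rho) in *. set (e2 := ball l2 rho) in *.
  assert (T12 := table_entry e1 e2 m L1 T). assert (T21 := table_entry e2 e1 m L2 (eq_sym T)).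
  assert (nd1 : NoDup e1) by apply (ball_NoDup H1).
  assert (nd2 : NoDup e2) by apply (ball_NoDup H2).
  assert (le : forall (Ga Gb : Group) (ea : list Ga) (eb : list Gb), In gone ea ->
    (forall i j k, entry ea i j k -> entry eb i j k) -> (length ea <= length eb)%nat).
  { intros Ga Gb ea eb I1 Tab. destruct (In_nth _ _ gone I1) as [j [Lj Ej]].
    destruct (length ea) as [|n] eqn:En; [lia|].
    destruct (Tab n j n) as [A _]; [|lia].
    unfold entry. rewrite Ej, gone_r, En. auto. }
  assert (Len : length e1 = length e2).
  { apply Nat.le_antisymm; apply le; auto.
    - apply (in_ball H1). rewrite (hl_one H1). lra.
    - apply (in_ball H2). rewrite (hl_one H2). lra. }
  assert (K : forall (Ga Gb : Group) (la : Ga -> R) (lb : Gb -> R)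
    (Ha : hyp_length la delta E) (Hb : hyp_length lb delta E),
    length (ball la rho) = length (ball lb rho) ->
    (forall i j k, entry (ball la rho) i j k -> entry (ball lb rho) i j k) ->
    (forall a, la a <= rho -> lb (transport (ball la rho) (ball lb rho) a) <= rho /\
      transport (ball lb rho) (ball la rho) (transport (ball la rho) (ball lb rho) a) = a) /\
    (forall a b, la a <= rho -> la b <= rho -> la (gmul a b) <= rho ->
      transport (ball la rho) (ball lb rho) (gmul a b) =
      gmul (transport (ball la rho) (ball lb rho) a) (transport (ball la rho) (ball lb rho) b))).
  { intros Ga Gb la lb Ha Hb Lab Tab.
    assert (nda := ball_NoDup Ha rho). assert (ndb := ball_NoDup Hb rho).
    assert (idx : forall a, la a <= rho ->
      exists i, (i < length (ball la rho))%nat /\ nth i (ball la rho) gone = a).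
    { intros a La. apply (in_ball Ha) in La. now apply In_nth. }
    split.
    - intros a La. destruct (idx a La) as [i [Li <-]].
      rewrite transport_nth by auto. split.
      + apply (in_ball Hb), nth_In. lia.
      + apply transport_nth; auto. lia.
    - intros a b La Lb Lc.
      destruct (idx a La) as [i [Li Ei]], (idx b Lb) as [j [Lj Ej]], (idx _ Lc) as [k [Lk Ek]].
      destruct (Tab i j k) as (_ & _ & _ & X).
      { unfold entry. rewrite Ei, Ej, Ek. auto. }
      rewrite <- Ek, <- Ei, <- Ej, !transport_nth by auto. auto. }
  destruct (K G1 G2 l1 l2 H1 H2 Len T12) as [A1 B1].
  destruct (K G2 G1 l2 l1 H2 H1 (eq_sym Len) T21) as [A2 B2].
  exact (ball_iso_extends H1 H2 rho _ _ Hr A1 A2 B1 B2).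
Qed.

(** * Counting *)

Lemma metric_four_point {X : Type} (d : X -> X -> R) (delta : R) (w x y z : X) :
  is_metric d -> geodesic_space d -> thin_triangles d delta ->
  Rmin (gprod d w x y) (gprod d w y z) - delta <= gprod d w x z.
Proof.
  intros (nn & _ & sym & tri) geo thin.
  set (t := Rmin (gprod d w x y) (gprod d w y z)).
  assert (t1 : t <= gprod d w x y) by apply Rmin_l.
  assert (t2 : t <= gprod d w y z) by apply Rmin_r.
  assert (t0 : 0 <= t).
  { unfold t, gprod. assert (A := tri x w y). assert (B := tri y w z).
    rewrite (sym x w) in A. rewrite (sym y w) in B. apply Rmin_glb; lra. }
  assert (tx : t <= d w x).
  { unfold gprod in t1. assert (A := tri w x y). lra. }
  assert (tz : t <= d w z).
  { unfold gprod in t2. assert (A := tri w z y). rewrite (sym z y) in A. lra. }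
  destruct (geo w x) as [a Ha], (geo x y) as [b Hb], (geo y w) as [c Hc],
    (geo y z) as [e He], (geo z w) as [f Hf].
  destruct (thin w x y a b c Ha Hb Hc) as [T1 _].
  assert (Hc' : geod_seg d w y (fun s => c (d y w - s))).
  { destruct Hc as (c0 & c1 & cc). split; [|split].
    - now rewrite Rminus_0_r.
    - now rewrite (sym w y), Rminus_diag.
    - intros s s' Hs Hs'. rewrite (sym w y) in Hs, Hs'.
      rewrite cc by lra. rewrite (Rabs_minus_sym s). f_equal. lra. }
  destruct (thin w y z _ e f Hc' He Hf) as [T2 _].
  specialize (T1 t (conj t0 t1)). specialize (T2 t (conj t0 t2)). simpl in T2.
  assert (L1 : d x (a t) = d w x - t).
  { destruct Ha as (a0 & a1 & aa). rewrite <- a1 at 1. rewrite aa by lra.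
    rewrite Rabs_right; lra. }
  assert (L2 : d (f (d z w - t)) z = d w z - t).
  { destruct Hf as (f0 & _ & ff). rewrite (sym z w) in *.
    transitivity (d (f (d w z - t)) (f 0)); [now rewrite f0|].
    rewrite ff by lra. rewrite Rabs_right; lra. }
  assert (A1 := tri x (a t) z). assert (A2 := tri (a t) (c (d y w - t)) z).
  assert (A3 := tri (c (d y w - t)) (f (d z w - t)) z).
  unfold gprod. lra.
Qed.

Lemma action_hyp_length {G : Group} {X : Type} (d : X -> X -> R) (act : G -> X -> X)
  (delta D : R) (x0 : X) :
  0 < delta -> 0 < D -> hyperbolic_space d delta -> isom_action G d act ->
  proper_action G d act -> quotient_diam_le G d act D ->
  hyp_length (fun g => d x0 (act g x0)) delta (2 * D).
Proof.
  intros dp Dp (met & prop & geo & thin) (a1 & am & ai) pr qd.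
  assert (met' := met). destruct met as (nn & id & sym & tri).
  set (l := fun g => d x0 (act g x0)).
  assert (dl : forall g h, ldist l g h = d (act g x0) (act h x0)).
  { intros g h. unfold ldist, l. rewrite <- (ai g x0), <- am. f_equal. f_equal. apply gmul_invK. }
  constructor; auto.
  - lra.
  - unfold l. rewrite a1. now apply id.
  - intros g. unfold l. rewrite <- (ai g), <- am, ginv_r, a1. apply sym.
  - intros g h. unfold l. rewrite am. assert (A := tri x0 (act g x0) (act g (act h x0))).
    rewrite ai in A. exact A.
  - intros x y z w. rewrite !dl.
    assert (F := metric_four_point d delta (act w x0) (act x x0) (act y x0) (act z x0)
                   met' geo thin).
    unfold gprod, Rmin in F.
    rewrite (sym (act y x0) (act w x0)), (sym (act z x0) (act w x0)),
      (sym (act x x0) (act w x0)).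
    destruct (Rle_dec _ _) in F; lra.
  - intros g t Ht. destruct (geo x0 (act g x0)) as [c (c0 & c1 & cc)].
    destruct (qd (c t) x0 D Dp) as [h Hh]. exists h. rewrite dl. unfold l in *. split.
    + assert (A := tri x0 (c t) (act h x0)).
      assert (B : d x0 (c t) = t); [|lra].
      transitivity (d (c 0) (c t)); [now rewrite c0|].
      rewrite cc by lra. rewrite Rabs_left1; lra.
    + assert (A := tri (act h x0) (c t) (act g x0)). rewrite (sym (act h x0) (c t)) in A.
      assert (B : d (c t) (act g x0) = d x0 (act g x0) - t); [|lra].
      transitivity (d (c t) (c (d x0 (act g x0)))); [now rewrite c1|].
      rewrite cc by lra. rewrite Rabs_left1; lra.
  - intros r. apply pr.
Qed.

Lemma BGT_ball {G : Group} {l : G -> R} {delta E : R} (H : hyp_length l delta E)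
  (nu : R -> nat) (h K r : R) :
  BGT_function nu -> torsion_free G -> 0 < h -> growth_le l h ->
  100 * (E + 2 * delta) <= r -> 243 * exp (8 * (h * r)) <= K ->
  exists (G0 : G -> Prop) (ts : list G), subgroup G0 /\
    nilpotent_mod G0 (fun x => x = gone) /\ (length ts <= nu K)%nat /\
    forall a, l a <= r -> exists t, In t ts /\ G0 (gmul (ginv t) a).
Proof.
  intros [_ [c bgt]] tf hp gr Lr LK. assert (dp := hl_delta H). assert (Ep := hl_E H).
  set (A := fun g => l g <= r).
  assert (hr : 0 < h * r) by nra.
  assert (K1 : 1 <= K).
  { assert (X := exp_ineq1_le (8 * (h * r))). nra. }
  assert (cA : has_card A (length (ball l r))).
  { exists (ball l r). split; [|split]; auto; apply (ball_spec H). }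
  assert (sub : forall g, prodset A A g -> In g (ball l (2 * r))).
  { intros g (a & b & Ha & Hb & ->). apply (in_ball H). assert (X := hl_mul H a b).
    unfold A in *. lra. }
  destruct (finite_enum (prodset A A)) as [s [nds Hs]]; [now exists (ball l (2 * r))|].
  assert (b1 := bcard_pos H r ltac:(lra)).
  assert (pos : (0 < length (ball l r))%nat) by (apply INR_lt; unfold bcard in b1; simpl; lra).
  destruct (bgt K K1 G A A _ _ (length s) cA cA pos pos) as (G0 & L & sG & nL & fL & nil & _ & cov).
  - exists s. auto.
  - rewrite Rmult_assoc, sqrt_def by apply pos_INR.
    apply Rle_trans with (bcard l (2 * r)).
    + apply le_INR, NoDup_incl_length; auto. intros g Hg. now apply sub, Hs.
    + assert (Y := ball_doubling H h r hp gr Lr). unfold bcard in *.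
      apply Rle_trans with (1 := Y). apply Rmult_le_compat_r; lra.
  - destruct cov as [ts [Lt cov]]. exists G0, ts. split; auto. split; auto.
    destruct nil as [k Hk]. exists k. intros x Hx.
    destruct nL as [sL _]. now apply (finite_subgroup_trivial tf L), Hk.
Qed.

(* Either a conjugate of the nilpotent group [G0] meets it trivially, and then the cosets
   of [G0] separate the elements of the conjugate, or [G0] is commensurated. *)
Lemma cyclic_or_small_ball {G : Group} {l : G -> R} {delta E : R} (H : hyp_length l delta E)
  (nu : R -> nat) (h K r rho : R) :
  BGT_function nu -> torsion_free G -> 0 < h -> growth_le l h ->
  100 * (E + 2 * delta) <= r -> 243 * exp (8 * (h * r)) <= K ->
  2 * E + 4 * delta <= rho -> 4 * rho <= r ->
  (cyclic G /\ exists x : G, x <> gone) \/ (length (ball l rho) <= nu K * nu K)%nat.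
Proof.
  intros bgt tf hp gr Lr LK Lrho L4. assert (dp := hl_delta H). assert (Ep := hl_E H).
  destruct (BGT_ball H nu h K r bgt tf hp gr Lr LK) as (G0 & ts & sG & nil & Lts & cov).
  assert (sG' := sG). destruct sG' as (S1 & Sm & Si).
  destruct (classic (exists g, l g <= rho /\ forall w, G0 w -> G0 (conjg g w) -> w = gone))
    as [[g [Lg Hg]]|N].
  - right. apply Nat.le_trans with (length ts * nu K)%nat; [|now apply Nat.mul_le_mono_r].
    apply (NoDup_length_classes _ _ (fun x t => G0 (gmul (ginv t) x))).
    + apply (ball_NoDup H).
    + intros x Hx. apply (in_ball H) in Hx. apply cov. lra.
    + intros t s' nd inc Hs'. apply Nat.le_trans with (2 := Lts).
      destruct s' as [|x0 s0]; [simpl; lia|]. set (s' := x0 :: s0) in *.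
      apply (NoDup_length_rel _ _
        (fun x u => G0 (gmul (ginv u) (conjg g (gmul (ginv x0) x))))); auto.
      * intros x Hx. apply cov.
        assert (A := hl_mul H g (gmul (gmul (ginv x0) x) (ginv g))).
        assert (B := hl_mul H (gmul (ginv x0) x) (ginv g)).
        assert (C := hl_mul H (ginv x0) x). rewrite !(hl_inv H) in *.
        assert (I0 : l x0 <= rho) by (apply (in_ball H), inc; now left).
        assert (I1 : l x <= rho) by (apply (in_ball H), inc; auto).
        unfold conjg. lra.
      * intros x y u Hx Hy Ux Uy.
        assert (E1 : gmul (ginv x) y = gone).
        { apply Hg.
          - replace (gmul (ginv x) y)
              with (gmul (ginv (gmul (ginv t) x)) (gmul (ginv t) y)) by grp.
            apply Sm; [apply Si|]; auto.
          - replace (conjg g (gmul (ginv x) y))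
              with (gmul (ginv (gmul (ginv u) (conjg g (gmul (ginv x0) x))))
                         (gmul (ginv u) (conjg g (gmul (ginv x0) y)))).
            + apply Sm; [apply Si|]; auto.
            + unfold conjg. grp. }
        rewrite <- (gone_r x), <- E1. now rewrite gmul_invK.
  - left.
    assert (W : forall g, l g <= rho -> exists w, w <> gone /\ G0 w /\ G0 (conjg g w)).
    { intros g Lg. apply NNPP. intros M. apply N. exists g. split; auto.
      intros w W1 W2. apply NNPP. intros nw. apply M. now exists w. }
    assert (cs := hyp_centralizers_small H tf).
    destruct (nilpotent_center G0 nil sG) as (z & nz & Gz & Cz).
    { destruct (W gone) as (w & nw & Gw & _); [rewrite (hl_one H); lra|]. now exists w. }
    split; [|now exists z].
    apply (cyclic_of_commensurated tf cs z (fun s => l s <= rho)); auto.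
    + apply (ball_generates H rho Lrho).
    + intros s Ls. destruct (W s Ls) as (w & nw & Gw & Gsw).
      apply (commute_trans tf cs (conjg s w)).
      * intros E1. now apply conj_eq_one in E1.
      * now apply commute_sym, Cz.
      * apply commute_conj, commute_sym, Cz, Gw.
Qed.

Fixpoint bool_words (k : nat) : list (list bool) :=
  match k with
  | O => nil :: nil
  | S k => map (cons true) (bool_words k) ++ map (cons false) (bool_words k)
  end.

Lemma bool_words_length (k : nat) : length (bool_words k) = (2 ^ k)%nat.
Proof. induction k; simpl; auto. rewrite length_app, !length_map. lia. Qed.

Lemma in_bool_words (w : list bool) : In w (bool_words (length w)).
Proof.
  induction w as [|b w IH]; simpl; auto. apply in_app_iff.
  destruct b; [left|right]; now apply in_map.
Qed.

Lemma ForallOrdPairs_filter {A : Type} (P : A -> A -> Prop) (p : A -> bool) (s : list A) :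
  ForallOrdPairs P s -> ForallOrdPairs P (filter p s).
Proof.
  induction 1 as [|a s Ha _ IH]; simpl; [constructor|].
  destruct (p a); auto. constructor; auto.
  rewrite Forall_forall in *. intros x Hx. apply Ha. now apply filter_In in Hx.
Qed.

Lemma ForallOrdPairs_NoDup_map {A B : Type} (P : A -> A -> Prop) (f : A -> B) (s : list A) :
  ForallOrdPairs P s -> (forall x y, In x s -> In y s -> f x = f y -> ~ P x y) ->
  NoDup (map f s).
Proof.
  induction 1 as [|a s Ha _ IH]; simpl; intros K; [constructor|]. constructor.
  - intros I. apply in_map_iff in I as [x [E I]]. rewrite Forall_forall in Ha.
    apply (K a x); auto.
  - apply IH. auto.
Qed.

Lemma count_classes (L : list Group) (C : Group -> Prop) (Code : Group -> list bool -> Prop)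
  (k : nat) :
  ForallOrdPairs (fun G1 G2 => ~ group_iso G1 G2) L ->
  (forall G, In G L -> C G \/ exists c, length c = k /\ Code G c) ->
  (forall G1 G2, In G1 L -> In G2 L -> C G1 -> C G2 -> group_iso G1 G2) ->
  (forall G1 G2 c, In G1 L -> In G2 L -> Code G1 c -> Code G2 c -> group_iso G1 G2) ->
  (length L <= 1 + 2 ^ k)%nat.
Proof.
  intros fop cl isoC isoK.
  set (p := fun G => if excluded_middle_informative (C G) then true else false).
  rewrite <- (filter_length p L).
  assert (Hp : forall G, In G (filter p L) -> In G L /\ C G).
  { intros G HG. apply filter_In in HG as [HG Hc]. split; auto. unfold p in Hc.
    now destruct (excluded_middle_informative (C G)). }
  assert (Hn : forall G, In G (filter (fun G => negb (p G)) L) ->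
                 In G L /\ exists c, length c = k /\ Code G c).
  { intros G HG. apply filter_In in HG as [HG Hc]. split; auto. unfold p in Hc.
    destruct (excluded_middle_informative (C G)) as [|n]; [discriminate|].
    destruct (cl G HG); tauto. }
  assert (L1 : (length (filter p L) <= 1)%nat).
  { rewrite <- (length_map (fun _ => tt)).
    change 1%nat with (length (tt :: nil)). apply NoDup_incl_length.
    - apply (ForallOrdPairs_NoDup_map _ _ _ (ForallOrdPairs_filter _ p L fop)).
      intros G1 G2 I1 I2 _ ni. apply ni. apply Hp in I1, I2. now apply isoC.
    - intros [] _. now left. }
  assert (L2 : (length (filter (fun G => negb (p G)) L) <= 2 ^ k)%nat).
  { set (code := fun G => epsilon (inhabits nil) (fun c => length c = k /\ Code G c)).
    assert (Hc : forall G, In G (filter (fun G => negb (p G)) L) ->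
                   length (code G) = k /\ Code G (code G)).
    { intros G HG. apply Hn in HG as [_ HG]. exact (epsilon_spec _ _ HG). }
    rewrite <- bool_words_length, <- (length_map code). apply NoDup_incl_length.
    - apply (ForallOrdPairs_NoDup_map _ _ _ (ForallOrdPairs_filter _ _ L fop)).
      intros G1 G2 I1 I2 E ni. apply ni.
      destruct (Hc G1 I1) as [_ K1], (Hc G2 I2) as [_ K2]. rewrite E in K1.
      apply (isoK G1 G2 (code G2)); auto; now apply Hn.
    - intros c Ic. apply in_map_iff in Ic as [G [<- IG]].
      destruct (Hc G IG) as [Lc _]. assert (X := in_bool_words (code G)).
      now rewrite Lc in X. }
  lia.
Qed.

Definition trivial_group : Group :=
  MkGroup unit (fun _ _ => tt) tt (fun _ => tt) (fun _ _ _ => eq_refl)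
    (fun x => match x with tt => eq_refl end) (fun _ => eq_refl).

Lemma BGT_function_pos (nu : R -> nat) (K : R) : BGT_function nu -> 1 <= K -> (1 <= nu K)%nat.
Proof.
  intros [_ [c bgt]] K1.
  assert (cA : forall P : trivial_group -> Prop, P tt -> has_card P 1).
  { intros P Pt. exists (tt :: nil). split; [|split]; auto.
    - constructor; [easy|constructor].
    - intros []. simpl. tauto. }
  set (A := fun _ : trivial_group => True).
  destruct (bgt K K1 trivial_group A A 1%nat 1%nat 1%nat) as (G0 & L & _ & _ & _ & _ & _ & ts & Lt & cov);
    auto; try (apply cA; exact I).
  - apply cA. now exists tt, tt.
  - simpl. rewrite sqrt_1. lra.
  - destruct (cov tt I) as [t [It _]]. destruct ts; [easy|]. simpl in Lt. lia.
Qed.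

Lemma nat_floor_ge (x : R) (n : nat) : INR n <= x -> (n <= nat_floor x)%nat.
Proof.
  intros L. unfold nat_floor. destruct (base_Int_part x) as [_ B].
  rewrite INR_IZR_INZ in L. assert (IZR (Z.of_nat n) < IZR (Int_part x + 1)).
  { rewrite plus_IZR. lra. }
  apply lt_IZR in H. lia.
Qed.

Lemma sum_ge_ends (a : nat -> R) (n : nat) :
  (forall i, 0 <= a i) -> (1 <= n)%nat -> a O + a n <= sum_f_R0 a n.
Proof.
  intros pos Ln. destruct n as [|n]; [lia|]. simpl. apply Rplus_le_compat_r.
  clear Ln. induction n as [|n IH]; simpl; [lra|]. specialize (pos (S n)). lra.
Qed.

Lemma N1_ge (nu : R -> nat) (delta h : R) (v : nat) :
  0 < delta -> (1 <= v)%nat -> INR v <= Nfun nu delta h 1 ->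
  1 + 2 ^ ((v * v) ^ 3) <= N1 nu delta h.
Proof.
  intros dp v1 Lv. unfold N1. set (F := nat_floor (Nfun nu delta h 1)).
  assert (LF : (v <= F)%nat) by now apply nat_floor_ge.
  apply Rle_trans with (2 := sum_ge_ends (fun i => Rpower 2 (rpow (2 * INR i) (4 * delta + 6)))
    F (fun i => Rlt_le _ _ (exp_pos _)) ltac:(lia)).
  apply Rplus_le_compat.
  - right. unfold rpow. simpl INR. destruct (Rle_dec (2 * 0) 0); [|lra].
    now rewrite Rpower_O by lra.
  - rewrite <- Rpower_pow by lra.
    assert (F1 : 1 <= INR F) by (apply (le_INR 1); lia).
    assert (X : INR ((v * v) ^ 3) <= rpow (2 * INR F) (4 * delta + 6)).
    { unfold rpow. destruct (Rle_dec (2 * INR F) 0); [lra|].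
      apply Rle_trans with (Rpower (2 * INR F) 6).
      - replace 6 with (INR 6) by (simpl; lra). rewrite Rpower_pow by lra.
        replace ((v * v) ^ 3)%nat with (v ^ 6)%nat by (simpl; ring). rewrite pow_INR.
        apply pow_incr. split; [apply pos_INR|]. apply le_INR in LF. lra.
      - apply Rle_Rpower; lra. }
    apply Rle_Rpower; lra.
Qed.

Lemma Nfun_ge (nu : R -> nat) (delta h D : R) :
  0 < delta -> 0 < D -> INR (nu (243 * exp (72 * h * (D + delta)))) <= Nfun nu delta h D.
Proof.
  intros dp Dp. unfold Nfun.
  assert (A := pos_INR (nu (243 * exp (72 * h * (D + delta))))).
  assert (B := pos_INR (nu (243 * exp (73 * h * (D + 4 * delta))))).
  assert (C : 0 <= 20 * (D + delta) / (5 * D + delta)).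
  { left. apply Rdiv_lt_0_compat; lra. }
  assert (X := Rmult_le_pos _ _ C (Rplus_le_le_0_compat _ _ B (Rlt_le 0 2 ltac:(lra)))).
  assert (Y := Rmult_le_pos _ _ A X). lra.
Qed.

Theorem mainTheorem12 (nu : R -> nat) (delta H D : R) :
  BGT_function nu -> 0 < delta -> 0 < H -> 0 < D ->
  forall l : list Group,
    (forall G, In G l -> in_class_H delta H D G) ->
    ForallOrdPairs (fun G1 G2 => ~ group_iso G1 G2) l ->
    INR (length l) <= N2 nu delta H D.
Proof.
  intros bgt dp Hp Dp L HL fop.
  set (delta' := 16 * (delta / D + 2)).
  assert (dp' : 0 < delta').
  { unfold delta'. assert (0 < delta / D) by (apply Rdiv_lt_0_compat; lra). lra. }
  set (K := 243 * exp (72 * (10 * H * D) * (1 + delta'))).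
  assert (EK : 72 * (10 * H * D) * (1 + delta') = 720 * (H * (33 * D + 16 * delta))).
  { unfold delta'. field. lra. }
  set (r := 200 * (D + delta)). set (rho := 4 * (D + delta)).
  assert (HD : 0 < H * D) by nra. assert (Hd : 0 < H * delta) by nra.
  assert (LK : 243 * exp (8 * (H * r)) <= K).
  { unfold K. apply Rmult_le_compat_l; [lra|]. apply exp_le. rewrite EK. unfold r. nra. }
  assert (K1 : 1 <= K).
  { assert (X := exp_ineq1_le (8 * (H * r))). assert (0 < H * r) by (unfold r; nra). lra. }
  set (v := nu K). assert (v1 : (1 <= v)%nat) by now apply BGT_function_pos.
  apply Rle_trans with (1 + 2 ^ ((v * v) ^ 3)).
  - replace (1 + 2 ^ ((v * v) ^ 3)) with (INR (1 + 2 ^ ((v * v) ^ 3)))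
      by (rewrite plus_INR, pow_INR; now replace (INR 2) with 2 by (simpl; lra)).
    apply le_INR.
    apply (count_classes L
      (fun G => torsion_free G /\ cyclic G /\ exists x : G, x <> gone)
      (fun G c => exists l : G -> R, hyp_length l delta (2 * D) /\
         (length (ball l rho) <= v * v)%nat /\ table (ball l rho) (v * v) = c)); auto.
    + intros G HG.
      destruct (HL G HG) as [tf [X [d [act (hyp & iso & pr & [x0 ent] & qd)]]]].
      set (l := fun g => d x0 (act g x0)).
      assert (hl : hyp_length l delta (2 * D))
        by now apply (action_hyp_length d act delta D x0).
      destruct (cyclic_or_small_ball hl nu H K r rho bgt tf Hp ent) as [C|S];
        auto; try (unfold r, rho; lra).
      right. exists (table (ball l rho) (v * v)). split; [apply table_length|now exists l].
    + intros G1 G2 _ _ (tf1 & c1 & n1) (tf2 & c2 & n2). now apply cyclic_iso.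
    + intros G1 G2 c _ _ [l1 (h1 & s1 & t1)] [l2 (h2 & s2 & t2)].
      apply (table_iso h1 h2 rho (v * v)); auto; [unfold rho; lra|congruence].
  - unfold N2. fold delta'. apply N1_ge; auto. unfold v, K. apply Nfun_ge; lra.
Qed.
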